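(* Let $X=\{0,1\}^{\mathbb{Z}}$ and let $T:X\to X$ be the two-sided full shift. Let $\alpha>0$ be a real number and let $(\beta_n)$ be a strictly increasing (finite or infinite) sequence of real numbers in $[\alpha,\infty)$. Then there exists a continuous potential $\phi:X\to\mathbb{R}$ such that both of the following hold: (i) For every $\beta\ge\alpha$, the potential $\phi$ has a phase transition at $\beta$ if and only if $\beta=\beta_n$ for some $n$. (ii) If the sequence $(\beta_n)$ is infinite and $\lim_{n\to\infty}\beta_n=\beta_\infty<\infty$, then the set of equilibrium states of $\beta\phi$ is the same for all $\beta\ge\beta_\infty$.
   Context: $X=\{0,1\}^{\mathbb{Z}}$ carries the product topology and $T(x)_n=x_{n+1}$. For a continuous $\psi:X\to\mathbb{R}$ the topological pressure is $P_{\rm top}(\psi)=\sup_{\mu}\left(h_\mu(T)+\int_X\psi\,d\mu\right)$, where the supremum is over all $T$-invariant Borel probability measures $\mu$ on $X$ and $h_\mu(T)$ is the measure-theoretic entropy; all logarithms (including those in the definition of entropy) are to base 2. An equilibrium state of $\psi$ is a $T$-invariant Borel probability measure attaining this supremum. The potential $\phi$ is said to have a phase transition at $\beta_0$ if the function $\beta\mapsto P_{\rm top}(\beta\phi)$ (defined for $\beta\in\mathbb{R}$) is not differentiable at $\beta_0$. *)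

(* Defs.v *)
From HB Require Import structures.
From mathcomp Require Import all_boot all_order all_algebra.
From mathcomp Require Import all_classical all_reals all_analysis.

Set Implicit Arguments.
Unset Strict Implicit.
Unset Printing Implicit Defensive.

Import Order.TTheory GRing.Theory Num.Theory.
Import numFieldNormedType.Exports.

Local Open Scope classical_set_scope.
Local Open Scope ring_scope.

(* As in [cantor_space], bool carries its discrete topology. *)
Definition full_shift := prod_topology (fun _ : int => bool).

HB.instance Definition _ := Pointed.on full_shift.
HB.instance Definition _ := Nbhs.on full_shift.
HB.instance Definition _ := Topological.on full_shift.

Definition shift_map (x : full_shift) : full_shift := fun n : int => x (n + 1).

(* The same points, with the Borel sigma-algebra. *)
Definition borel_full_shift := g_sigma_algebraType (@open full_shift).

Section thermodynamic_formalism.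
Context {R : realType}.
Implicit Types (mu : probability borel_full_shift R).

Definition shift_invariant mu : Prop :=
  forall A : set borel_full_shift, measurable A -> mu (shift_map @^-1` A) = mu A.

Definition log2 (p : R) : R := ln p / ln 2.

(* A partition of X into at most k measurable sets is given by its labelling
   xi : X -> 'I_k; some cells may be empty, which does not affect entropies. *)
Definition measurable_labelling (k : nat) (xi : borel_full_shift -> 'I_k) : Prop :=
  forall i : 'I_k, measurable (xi @^-1` [set i]).

(* The cells of the join of xi, T^-1 xi, ..., T^-(n-1) xi are indexed by the
   words w of length n over 'I_k (with repetition of the empty cell only). *)
Definition join_cell (k : nat) (xi : borel_full_shift -> 'I_k) (n : nat)
    (w : {ffun 'I_n -> 'I_k}) : set borel_full_shift :=
  [set x | forall j : 'I_n, xi (iter j shift_map x) = w j].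

(* The convention 0 log 0 = 0 holds automatically. *)
Definition join_entropy mu (k : nat) (xi : borel_full_shift -> 'I_k) (n : nat) : R :=
  \sum_(w : {ffun 'I_n -> 'I_k})
    - (fine (mu (join_cell xi w)) * log2 (fine (mu (join_cell xi w)))).

Definition partition_entropy mu (k : nat) (xi : borel_full_shift -> 'I_k) : R :=
  limn (fun n : nat => join_entropy mu xi n / n%:R).

Definition entropy mu : \bar R :=
  ereal_sup [set h | exists (k : nat) (xi : borel_full_shift -> 'I_k),
    measurable_labelling xi /\ h = (partition_entropy mu xi)%:E].

Definition free_energy (psi : full_shift -> R) mu : \bar R :=
  (entropy mu + \int[mu]_x (psi x)%:E)%E.

Definition pressure (psi : full_shift -> R) : \bar R :=
  ereal_sup [set free_energy psi mu | mu in shift_invariant].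

Definition equilibrium_states (psi : full_shift -> R) :
    set (probability borel_full_shift R) :=
  [set mu | shift_invariant mu /\ free_energy psi mu = pressure psi].

(* The pressure of a continuous potential is finite, so that fine loses
   nothing for continuous phi. *)
Definition phase_transition_at (phi : full_shift -> R) (beta0 : R) : Prop :=
  ~ derivable (fun beta : R => fine (pressure (fun x => beta * phi x))) beta0 1.

End thermodynamic_formalism.

(* The index set of a sequence: {0, ..., m-1} if N = Some m, and all of nat
   (an infinite sequence) if N = None. *)
Definition seq_index (N : option nat) : set nat :=
  [set n | if N is Some m then (n < m)%N else True].

(* Main.v *)
Require Import Defs.
From HB Require Import structures.
From mathcomp Require Import all_boot all_order all_algebra.
From mathcomp Require Import all_classical all_reals all_analysis.
From mathcomp Require Import measurable_realfun.
From mathcomp Require Import zify ring lra.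

Set Implicit Arguments.
Unset Strict Implicit.
Unset Printing Implicit Defensive.

Import Order.TTheory GRing.Theory Num.Theory.
Import numFieldNormedType.Exports.

Local Open Scope classical_set_scope.
Local Open Scope ring_scope.

(** Everything rests on one function, [rate], on the full shift.  It is
continuous and nonnegative, it dominates entropy (the entropy of every invariant
measure is at most the mean of [rate], see [entropy_le_mean_rate]), and for every
l >= 3 there is an invariant measure of entropy at least 1/l under which [rate]
is 1/l almost everywhere ([substitute_measure]).

Such a function turns any suitable convex function P into a pressure.  Put
g(t) = inf (P(y) - t) / y over y >= alpha / 2, and phi = g o rate.  Pointwise
rate + y phi <= P(y), so h + y int phi <= int (rate + y phi) <= P(y) for every
invariant measure of entropy h: the pressure of y phi is at most P(y).
Conversely, if the line 1/l + y s lies below P then g(1/l) >= s, so the l-th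
measure shows that the pressure is at least 1/l + y s.  Hence the pressure is P
whenever P is a supremum of lines whose values at 0 are among the numbers 1/l,
l >= 3 ([pressure_potential]).

Take h_k = 1/(k+3), d_k = h_k - h_(k+1) and
P(y) = h_0 + sum_k d_k max(y / beta_k - 1, 0).  As the beta_k increase, P is the
supremum of the lines obtained by opening the first n hinges
([support_line_le], [support_line_attained]), and their values at 0 are the h_n.
P has a corner at each beta_k ([hinge_series_not_derivable]) and none elsewhere,
not even where the beta_k accumulate, because the slopes of the hinges are
summable ([hinge_series_derivable]).  Beyond beta_oo = lim beta_k it is affine.
At such a parameter the integral of phi under an equilibrium state must be the
slope of that affine piece, so that the state remains an equilibrium state for
every other parameter beyond beta_oo ([potential_equilibrium_sub]).

The function [rate] comes from a code.  Certain 1s of a point, its starts, cut it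
into tokens, and only two words of each length l can be a token.  A token costs
one bit, plus the price of announcing its length: log (2 l (l+1)) when the length
differs from that of the preceding token, and log ((i+2)/i) when i tokens of that
same length precede it.  [rate] spreads the cost of a token evenly over its
symbols.  The price of a length is negligible compared with l when l is large,
and tends to 0 as i grows; this makes [rate] continuous ([rate_window]) and equal
to 1/l on the points all of whose tokens have length l.  The weights 2^-cost of
all codes of n symbols add up to at most a polynomial in n ([mass_le],
[window_codes_mass]), so Gibbs' inequality bounds the entropy of words of length n
by n int rate + o(n).
A general labelling is compared with one that depends on a window of coordinates,
and the same inequality pays for the rare disagreements ([join_entropy_le]). *)

(** * Tokens and their cost *)

(** The starts are the 1s other than the middle symbol of a pattern 110.  That
exception leaves the symbol after a start free to carry one bit. *)
Definition is_start (x : full_shift) (p : int) : bool :=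
  x p && ~~ (x (p - 1) && ~~ x (p + 1)).

(** A point is therefore determined by its starts and by the symbols that follow
them: a token of length l is 1 b 0 ... 0. *)
Lemma not_start_zero (x : full_shift) (p : int) :
  ~~ is_start x p -> ~~ is_start x (p - 1) -> x p = false.
Proof.
rewrite /is_start subrK; case: (x p) => //=.
by rewrite negbK => /andP[-> _]; rewrite andbF.
Qed.

Lemma iter_shiftE (x : full_shift) (j : nat) (p : int) :
  iter j shift_map x p = x (p + j%:Z).
Proof.
elim: j p => [|j IH] p /=; first by rewrite addr0.
by rewrite /shift_map IH; congr x; lia.
Qed.

Lemma is_start_iter (x : full_shift) (j : nat) (p : int) :
  is_start (iter j shift_map x) p = is_start x (p + j%:Z).
Proof.
by rewrite /is_start !iter_shiftE; congr (_ && ~~ (x _ && ~~ x _)); lia.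
Qed.

(** The token that covers the coordinates from -a to b - 1 and the i tokens before
it all have length a + b. *)
Definition run (x : full_shift) (a b i : nat) : Prop :=
  forall p : nat, (p <= i.+1 * (a + b))%N ->
    is_start x (b%:Z - p%:Z) = (a + b %| p)%N.

Lemma run_le (x : full_shift) (a b i j : nat) :
  (i <= j)%N -> run x a b j -> run x a b i.
Proof.
move=> ij h p hp; apply: h; apply: leq_trans hp _.
by rewrite leq_mul2r ltnS ij orbT.
Qed.

Lemma run_uniq (x : full_shift) (a b a' b' i i' : nat) : (0 < b)%N -> (0 < b')%N ->
  run x a b i -> run x a' b' i' -> a = a' /\ b = b'.
Proof.
move=> b0 b0' /(run_le (leq0n _)) h /(run_le (leq0n _)) h'.
have aux (c d c' d' : nat) : (0 < d)%N -> (0 < d')%N ->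
    run x c d 0 -> run x c' d' 0 -> (d' <= d)%N /\ (c' <= c)%N.
  move=> d0 d0' k k'; split; rewrite leqNgt; apply/negP => lt.
    have := k 0%N isT; rewrite subr0 dvdn0 => sd.
    have := k' (d' - d)%N; rewrite (_ : d'%:Z - _ = d%:Z); last by lia.
    rewrite sd gtnNdvd; [|lia..].
    by move=> H; have := H ltac:(lia).
  have := k (c + d)%N; rewrite dvdnn (_ : d%:Z - _ = - c%:Z); last by lia.
  move=> H; have {H} sd := H ltac:(lia).
  have := k' (d' + c)%N; rewrite (_ : d'%:Z - _ = - c%:Z); last by lia.
  rewrite sd gtnNdvd; [|lia..].
  by move=> H; have := H ltac:(lia).
have [] := aux _ _ _ _ b0 b0' h h'; have [] := aux _ _ _ _ b0' b0 h' h.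
by lia.
Qed.

Lemma run_iter (x : full_shift) (j b i : nat) :
  run (iter j shift_map x) j b i <-> run x 0 (j + b) i.
Proof.
rewrite /run add0n; split => h p hp; rewrite -h // is_start_iter;
  congr (is_start x _); lia.
Qed.

Lemma ln_le_affine {R : realType} (e : R) : 0 < e ->
  exists C : R, 0 <= C /\ forall y : R, 0 < y -> ln y <= e * y + C.
Proof.
move=> e0; exists `|ln e|; split => // y y0.
have := ln_sublinear (mulr_gt0 e0 y0); rewrite lnM ?posrE// => h.
have := ler_norm (- ln e); rewrite normrN. intros; intros; lra.
Qed.

Section rate.
Context {R : realType}.

Lemma ln2_pos : 0 < ln (2 : R).
Proof. by rewrite ln_gt0// ltr1n. Qed.

Lemma log2_le (a b : R) : 0 < a -> a <= b -> log2 a <= log2 b.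
Proof.
move=> a0 ab; rewrite /log2 ler_pM2r ?invr_gt0 ?ln2_pos//.
by rewrite ler_ln// posrE ?(lt_le_trans a0).
Qed.

Lemma log2M (a b : R) : 0 < a -> 0 < b -> log2 (a * b) = log2 a + log2 b.
Proof. by move=> a0 b0; rewrite /log2 lnM ?posrE// mulrDl. Qed.

Lemma log2V (a : R) : 0 < a -> log2 a^-1 = - log2 a.
Proof. by move=> a0; rewrite /log2 lnV ?posrE// mulNr. Qed.

Lemma log22 : log2 (2 : R) = 1.
Proof. by rewrite /log2 divff// gt_eqF ?ln2_pos. Qed.

Lemma log21 : log2 (1 : R) = 0.
Proof. by rewrite /log2 ln1 mul0r. Qed.

Lemma log2_le_affine (e : R) : 0 < e ->
  exists C : R, 0 <= C /\ forall y : R, 0 < y -> log2 y <= e * y + C.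
Proof.
move=> e0; have [C [C0 h]] := ln_le_affine (mulr_gt0 e0 ln2_pos).
exists (C / ln 2); split; first by rewrite divr_ge0// ltW ?ln2_pos.
move=> y y0; rewrite /log2 ler_pdivrMr ?ln2_pos// mulrDl divfK ?gt_eqF ?ln2_pos//.
by rewrite mulrAC h.
Qed.

(** The factor paid for the length of a token of length l that i tokens of the same
length precede.  Along a run of r tokens of length l these factors multiply to
1 / (l (l+1) r (r+1)), a probability on the pairs (l, r). *)
Definition run_weight (l i : nat) : R :=
  if i is 0%N then ((2 * l%:R) * (l%:R + 1))^-1 else i%:R / (i%:R + 2).

Lemma run_weight_gt0 (l i : nat) : (0 < l)%N -> 0 < run_weight l i.
Proof.
move=> l0; have l0' : 0 < l%:R :> R by rewrite ltr0n.
case: i => [|i] /=; first by rewrite invr_gt0 mulr_gt0// ?mulr_gt0//; intros; lra.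
have : 0 < i.+1%:R :> R by rewrite ltr0n.
by move=> i0; rewrite divr_gt0//; intros; lra.
Qed.

Lemma run_weightS_le (l i : nat) : (0 < l)%N -> run_weight l i <= run_weight l i.+1.
Proof.
move=> l0; have l0' : 1 <= l%:R :> R by rewrite ler1n.
case: i => [|i] /=.
  rewrite -[leLHS]mul1r ler_pdivrMr ?mulr_gt0//; [|lra..].
  by rewrite mulrAC ler_pdivlMr; intros; nra.
rewrite ler_pdivrMr ?addr_gt0 ?ltr0n// mulrAC ler_pdivlMr ?addr_gt0 ?ltr0n//.
have : 0 <= i%:R :> R by rewrite ler0n.
rewrite -!natr1; intros; nra.
Qed.

Lemma run_weight_le (l i j : nat) : (0 < l)%N -> (i <= j)%N -> run_weight l i <= run_weight l j.
Proof.
move=> l0 /subnK <-; elim: (j - i)%N => // k IH.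
by apply: le_trans IH _; rewrite addSn run_weightS_le.
Qed.

Lemma run_weight_le1 (l i : nat) : (0 < l)%N -> run_weight l i <= 1.
Proof.
move=> l0; apply: le_trans (run_weightS_le _ l0) _ => /=.
have : 0 <= i%:R :> R by rewrite ler0n.
by rewrite -natr1 => h; rewrite ler_pdivrMr; intros; lra.
Qed.

(** One bit for the symbol after the start and the price of the length, per symbol
of the token. *)
Definition unit_cost (l i : nat) : R := (1 - log2 (run_weight l i)) / l%:R.

Lemma unit_cost_ge (l i : nat) : (0 < l)%N -> l%:R^-1 <= unit_cost l i.
Proof.
move=> l0; rewrite /unit_cost -[leLHS]mul1r ler_pM2r ?invr_gt0 ?ltr0n//.
by have := log2_le (run_weight_gt0 i l0) (run_weight_le1 i l0); rewrite log21; intros; lra.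
Qed.

Lemma unit_cost_ge0 (l i : nat) : 0 <= unit_cost l i.
Proof.
case: l => [|l]; first by rewrite /unit_cost invr0 mulr0.
by apply: le_trans (unit_cost_ge _ _).
Qed.

Lemma unit_cost_le (l i j : nat) : (0 < l)%N -> (i <= j)%N ->
  unit_cost l j <= unit_cost l i.
Proof.
move=> l0 ij; rewrite /unit_cost ler_pM2r ?invr_gt0 ?ltr0n//.
by have := log2_le (run_weight_gt0 i l0) (run_weight_le l0 ij); intros; lra.
Qed.

Lemma unit_cost_sublinear (e : R) : 0 < e ->
  exists C : R, 0 <= C /\
    forall l i, (0 < l)%N -> unit_cost l i <= e + C / l%:R.
Proof.
move=> e0; have e2 : 0 < e / 2 by lra.
have [C [C0 hC]] := log2_le_affine e2.
exists (2 + C + C + e / 2); split; first by lra.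
move=> l i l0; apply: le_trans (unit_cost_le l0 (leq0n i)) _.
have l1 : 1 <= l%:R :> R by rewrite ler1n.
rewrite /unit_cost ler_pdivrMr ?ltr0n// mulrDl divfK ?pnatr_eq0 -?lt0n//.
rewrite /= log2V ?mulr_gt0//; [|lra..].
rewrite !log2M ?mulr_gt0//; [|lra..].
have := hC l%:R ltac:(lra); have := hC (l%:R + 1) ltac:(lra).
rewrite log22; intros; lra.
Qed.

Lemma unit_cost_small (e : R) : 0 < e ->
  exists L : nat, forall l i, (L <= l)%N -> (0 < l)%N -> unit_cost l i <= e.
Proof.
move=> e0; have [C [C0 hC]] := unit_cost_sublinear (ltac:(lra) : 0 < e / 2).
exists (Num.truncn (C / (e / 2))).+1 => l i Ll l0.
apply: le_trans (hC l i l0) _.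
suff : C / l%:R <= e / 2 by lra.
rewrite ler_pdivrMr ?ltr0n// -ler_pdivrMl; last by lra.
rewrite mulrC ltW//; apply: lt_le_trans (truncnS_gt _) _.
by rewrite ler_nat.
Qed.

Lemma unit_cost_stable (e : R) : 0 < e ->
  exists K : nat, forall l, (0 < l)%N -> unit_cost l K <= l%:R^-1 + e.
Proof.
move=> e0; exists (Num.truncn (2 / (e * ln 2))).+1 => l l0.
set K := Num.truncn _; rewrite /unit_cost mulrBl mul1r; apply: lerD => //.
have l1 : 1 <= l%:R :> R by rewrite ler1n.
rewrite -mulNr ler_pdivrMr ?ltr0n//.
have K0 : 0 < K.+1%:R :> R by rewrite ltr0n.
rewrite -log2V ?run_weight_gt0//= invf_div mulrDl divff ?gt_eqF//.
have := @le_ln1Dx R (2 / K.+1%:R)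
  ltac:(by rewrite (@lt_le_trans _ _ 0)// divr_ge0// ltW).
rewrite /log2 => h; apply: le_trans (_ : e <= _); last by rewrite ler_peMr// ltW.
rewrite ler_pdivrMr ?ln2_pos//; apply: le_trans h _.
rewrite ler_pdivrMr// -ler_pdivrMl ?mulr_gt0 ?ln2_pos//.
by rewrite mulrC ltW// truncnS_gt.
Qed.

Definition rate_values (x : full_shift) : set R :=
  [set v | exists a b i, [/\ (0 < b)%N, run x a b i & v = unit_cost (a + b) i]].

(** The cost decreases with i, so the infimum charges a token according to the
longest run that ends with it and gives the limit when that run is infinite.  As
the infimum of the empty set is 0, so is the rate of a point whose coordinate 0
lies in no finite token. *)
Definition rate (x : full_shift) : R := inf (rate_values x).

Lemma rate_values_lb (x : full_shift) : lbound (rate_values x) 0.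
Proof. by move=> _ [a [b [i [_ _ ->]]]]; exact: unit_cost_ge0. Qed.

Lemma rate_ge0 (x : full_shift) : 0 <= rate x.
Proof.
have [E|/set0P[v hv]] := eqVneq (rate_values x) set0; last first.
  by apply: lb_le_inf; [exists v|exact: rate_values_lb].
by rewrite /rate E inf0.
Qed.

Lemma rate_le (x : full_shift) (a b i : nat) : (0 < b)%N -> run x a b i ->
  rate x <= unit_cost (a + b) i.
Proof.
move=> b0 h; apply: ge_inf; first by exists 0; exact: rate_values_lb.
by exists a, b, i.
Qed.

Lemma rate_ge (x : full_shift) (a b : nat) (v : R) : (0 < b)%N -> run x a b 0 ->
  (forall i, run x a b i -> v <= unit_cost (a + b) i) -> v <= rate x.
Proof.
move=> b0 h hv; apply: lb_le_inf; first by exists (unit_cost (a + b) 0), a, b, 0%N.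
move=> _ [a' [b' [i [b0' h' ->]]]].
have [ea eb] := run_uniq b0' b0 h' h; rewrite ea eb in h' *.
exact: hv.
Qed.

Lemma rate_no_run (x : full_shift) :
  (forall a b, (0 < b)%N -> ~ run x a b 0) -> rate x = 0.
Proof.
move=> h; rewrite /rate (_ : rate_values x = set0) ?inf0//.
rewrite -subset0 => v [a [b [i [b0 r _]]]].
by case: (h a b b0); exact: run_le r.
Qed.

Definition agree (M : nat) (x y : full_shift) : Prop :=
  forall p : int, (`|p| <= M)%N -> x p = y p.

Lemma agree_sym (M : nat) (x y : full_shift) : agree M x y -> agree M y x.
Proof. by move=> h p hp; rewrite h. Qed.

Lemma agree_run (M : nat) (x y : full_shift) (a b i : nat) :
  (i.+1 * (a + b) < M)%N -> agree M x y -> run x a b i -> run y a b i.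
Proof.
move=> hM h r p hp; rewrite -r //.
by rewrite /is_start !h //; nia.
Qed.

(** Long tokens are cheap whatever precedes them.  For a short token, a run of at
least K tokens costs almost the limit, and a shorter run is visible in a window
of size K.+1 * L. *)
Lemma rate_window (e : R) : 0 < e ->
  exists M, forall x y, agree M x y -> rate y <= rate x + e.
Proof.
move=> e0; have [L hL] := unit_cost_small e0.
have [K hK] := unit_cost_stable e0.
exists (K.+1 * L).+1 => x y xy.
have [[a [b [b0 r]]]|nr] := pselect (exists a b, (0 < b)%N /\ run y a b 0); last first.
  rewrite (@rate_no_run y) ?addr_ge0 ?rate_ge0 ?ltW// => a b b0 r.
  by apply: nr; exists a, b.
have [Lab|abL] := leqP L (a + b).
  apply: le_trans (rate_le b0 r) _; apply: le_trans (hL _ _ Lab _) _; first by lia.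
  by rewrite lerDr rate_ge0.
have rx : run x a b 0 by apply: agree_run (agree_sym xy) r; nia.
rewrite -lerBlDr; apply: (rate_ge b0 rx) => i ri; rewrite lerBlDr.
have [iK|Ki] := leqP i K.
  apply: le_trans (_ : unit_cost (a + b) i <= _); last by rewrite lerDl ltW.
  by apply: rate_le => //; apply: agree_run xy ri; nia.
apply: le_trans (_ : unit_cost (a + b) K <= _).
  by apply: rate_le => //; apply: agree_run xy (run_le (ltnW Ki) ri); nia.
apply: le_trans (hK _ _) _; first by lia.
by rewrite lerD2r unit_cost_ge//; lia.
Qed.

End rate.

(** * Codes for the words of a point *)

Definition word (x : full_shift) (n : nat) : seq bool := mkseq (fun j => x j%:Z) n.

Lemma word_cat (x : full_shift) (m n : nat) :
  word x (m + n) = word x m ++ word (iter m shift_map x) n.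
Proof.
rewrite /word /mkseq iotaD map_cat add0n -[in iota m n](addn0 m) iotaDl -map_comp.
by congr (_ ++ _); apply: eq_map => j /=; rewrite iter_shiftE PoszD addrC.
Qed.

(** The symbols before the first start of a window: only the leftmost can be 1. *)
Definition gap_word (b : bool) (n : nat) : seq bool := take n (b :: nseq n false).

Definition token_word (b : bool) (n : nat) : seq bool :=
  take n (true :: b :: nseq n false).

Lemma word_no_start (x : full_shift) (n : nat) :
  (forall j, (j < n)%N -> ~~ is_start x j%:Z) -> word x n = gap_word (x 0) n.
Proof.
move=> h; apply: (@eq_from_nth _ false).
  by rewrite size_mkseq size_take /= size_nseq; case: ifP => // /negbT; lia.
move=> j; rewrite size_mkseq => jn; rewrite nth_mkseq// nth_take//.
case: j jn => [|j] jn //=; rewrite nth_nseq if_same.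
apply: not_start_zero; first exact: h.
by rewrite (_ : _ - 1 = j%:Z); [apply: h; lia|lia].
Qed.

Lemma word_token (x : full_shift) (n : nat) : is_start x 0 ->
  (forall j, (0 < j < n)%N -> ~~ is_start x j%:Z) -> word x n = token_word (x 1) n.
Proof.
case: n => [//|n] s0 h.
rewrite -add1n word_cat (@word_no_start (iter 1 shift_map x)); last first.
  by move=> j jn; rewrite (is_start_iter x 1) -PoszD; apply: h; lia.
rewrite /word /= /token_word /gap_word /= (_ : x 0 = true); last by case/andP: s0.
have tk k m : (k <= m)%N -> take k (nseq m false) = nseq k false.
  by move=> km; rewrite -(subnKC km) nseqD take_size_cat ?size_nseq.
case: n {h} => [|n] //=.
by rewrite -[false :: nseq n false]/(nseq n.+1 false)
  -[false :: nseq n.+1 false]/(nseq n.+2 false) !tk//; lia.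
Qed.

Section codes.
Context {R : realType}.

(** The length of the token just read and the number of tokens in the run that it
ends, or None when that number is not recorded. *)
Definition parse_state : Type := (nat * option nat)%type.

(** An unrecorded run continues for free.  This covers the run that enters a window
from the left, whose true length cannot be seen. *)
Definition step_weight (s : parse_state) (l : nat) : R :=
  if l == s.1 then (if s.2 is Some k then k%:R / (k%:R + 2) else 1)
  else run_weight l 0.

Definition next_state (s : parse_state) (l : nat) : parse_state :=
  if l == s.1 then (l, omap succn s.2) else (l, Some 1%N).

Definition token_shapes (n : nat) : seq (nat * bool) :=
  [seq (l, b) | l <- iota 1 n, b <- [:: false; true]].

Lemma mem_token_shapes (n l : nat) (b : bool) :
  (0 < l <= n)%N -> (l, b) \in token_shapes n.
Proof.
move=> ln; apply: (@allpairs_f _ _ _ pair); first by rewrite mem_iota; lia.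
by rewrite !inE; case: b.
Qed.

(** The parses of n symbols after a start, each with the word that it spells and its
weight: a sequence of tokens followed by an incomplete token, which is free. *)
Fixpoint codes (fuel n : nat) (s : parse_state) : seq (seq bool * R) :=
  [seq (token_word b n, 1) | b <- [:: false; true]] ++
  if fuel is N.+1 then
    flatten [seq [seq (token_word t.2 t.1 ++ c.1, step_weight s t.1 / 2 * c.2)
                 | c <- codes N (n - t.1) (next_state s t.1)]
            | t <- token_shapes n]
  else [::].

Definition mass (L : seq (seq bool * R)) : R := \sum_(c <- L) c.2.

(** The factor k + 1 solves B(k) = k / (k+2) * B(k+1) + 1, where the first term
continues a run of k tokens and 1 bounds the contribution of all new runs. *)
Definition mass_bound (n : nat) (o : option nat) : R :=
  if o is Some k then 2 * (n%:R + 1) * (k%:R + 1) else 2 * (n%:R + 1) ^+ 2.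

Lemma step_weight_ge0 (s : parse_state) (l : nat) : 0 <= step_weight s l.
Proof.
rewrite /step_weight; case: eqP => _; last by rewrite /= invr_ge0 !mulr_ge0 ?addr_ge0.
by case: s.2 => [k|] //; rewrite divr_ge0// addr_ge0.
Qed.

Lemma codes_ge0 (N n : nat) (s : parse_state) c : c \in codes N n s -> 0 <= c.2.
Proof.
elim: N n s c => [|N IH] n s c /=.
  by rewrite !inE => /orP[] /eqP ->.
rewrite !inE => /orP[/eqP -> //|/orP[/eqP -> //|]].
case/flattenP => L /mapP[t _ ->] /mapP[d hd -> /=].
by rewrite mulr_ge0 ?(IH _ _ _ hd)// divr_ge0 ?step_weight_ge0.
Qed.

Lemma mass_codesS (N n : nat) (s : parse_state) :
  mass (codes N.+1 n s) =
  2 + \sum_(1 <= l < n.+1) step_weight s l * mass (codes N (n - l) (next_state s l)).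
Proof.
rewrite /mass /= !big_cons addrA; congr (_ + _).
rewrite big_flatten big_map big_allpairs_dep /index_iota subn1 /=.
apply: eq_bigr => l _; rewrite !big_cons big_nil addr0 !big_map /=.
by rewrite -!mulr_sumr -mulrDl -splitr.
Qed.

Lemma sum_switch (n : nat) :
  \sum_(1 <= l < n.+1) run_weight l 0 <= 2^-1 :> R.
Proof.
suff -> : \sum_(1 <= l < n.+1) run_weight l 0 = 2^-1 - (2 * (n%:R + 1))^-1 :> R.
  by rewrite lerBlDr lerDl invr_ge0 mulr_ge0// addr_ge0.
elim: n => [|n IH]; first by rewrite big_geq// add0r mulr1 subrr.
rewrite big_nat_recr//= IH -natr1.
have : 0 <= n%:R :> R by [].
by move=> h; field; apply/andP; split; apply/eqP; lra.
Qed.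

Lemma mass_bound_le (m n : nat) (o : option nat) :
  (m <= n)%N -> mass_bound m o <= mass_bound n o.
Proof.
move=> mn; have h : m%:R <= n%:R :> R by rewrite ler_nat.
have m0 : 0 <= m%:R :> R by [].
case: o => [k|] /=; last by rewrite ler_pM2l// lerXn2r ?nnegrE; lra.
by rewrite ler_pM2r ?ltr_wpDl// ler_pM2l//; lra.
Qed.

(** Induction over the first token read: continuing the run contributes A, and the
new lengths contribute at most 2 n by [sum_switch]. *)
Lemma mass_le (N n : nat) (s : parse_state) :
  mass (codes N n s) <= mass_bound n s.2.
Proof.
elim: N n s => [|N IH] n s.
  rewrite /mass /= !big_cons big_nil /= addr0.
  have n0 : 0 <= n%:R :> R by []. 
  case: s.2 => [k|] /=; last nra.
  have k0 : 0 <= k%:R :> R by []. 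
  nra.
rewrite mass_codesS.
pose A : R := if s.2 is Some k then 2 * n%:R * k%:R else 2 * n%:R ^+ 2.
have A0 : 0 <= A by rewrite /A; case: s.2 => [k|]; rewrite !mulr_ge0 ?exprn_ge0.
have step : forall l, (1 <= l < n.+1)%N ->
    step_weight s l * mass (codes N (n - l) (next_state s l)) <=
    (l == s.1)%:R * A + run_weight l 0 * (4 * n%:R).
  move=> l /andP[l1 ln].
  have n1 : (n - l).+1%:R <= n%:R :> R by rewrite ler_nat; lia.
  rewrite -natr1 in n1.
  have kf : 0 <= run_weight l 0 * (4 * n%:R) :> R by rewrite mulr_ge0 ?mulr_ge0// ltW ?run_weight_gt0.
  apply: le_trans (ler_wpM2l (step_weight_ge0 s l) (IH _ _)) _.
  rewrite /step_weight /next_state; case: eqP => _ /=.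
    rewrite mul1r; apply: le_trans (_ : A <= _); last by rewrite lerDl.
    have m0 : 0 <= (n - l)%:R :> R by [].
    rewrite /A; case: s.2 => [k|] /=; last by rewrite mul1r ler_pM2l// lerXn2r ?nnegrE; lra.
    have k0 : 0 <= k%:R :> R by []. 
    rewrite -natr1 (_ : k%:R / (k%:R + 2) * _ = 2 * ((n - l)%:R + 1) * k%:R); last first.
      by field; apply/eqP; lra.
    by rewrite ler_wpM2r// ler_pM2l.
  rewrite mul0r add0r ler_wpM2l ?(ltW (run_weight_gt0 0 l1))//.
  by have -> : (1%:R + 1 = 2 :> R) by []; lra.
apply: le_trans (_ : 2 + (A + 2^-1 * (4 * n%:R)) <= _).
  rewrite lerD2l big_nat.
  apply: le_trans (ler_sum _ _) _; first exact: step.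
  rewrite -big_nat big_split /= -!mulr_suml lerD//; last first.
    by rewrite ler_wpM2r ?mulr_ge0// sum_switch.
  rewrite -[leRHS]mul1r ler_wpM2r// -natr_sum (ler_nat _ _ 1).
  rewrite -(big_map (fun i => (i == s.1) : nat) xpredT id) -sumnE sumn_count.
  by rewrite (@eq_count _ _ (pred1 s.1))// count_uniq_mem ?iota_uniq//; case: (_ \in _).
rewrite /A; case: s.2 => [k|] /=.
  have k0 : 0 <= k%:R :> R by []. 
  have n0 : 0 <= n%:R :> R by []. 
  lra.
have n0 : 0 <= n%:R :> R by []. 
nra.
Qed.

Definition pow2N (t : R) : R := expR (- (ln 2 * t)).

Lemma pow2ND (s t : R) : pow2N (s + t) = pow2N s * pow2N t.
Proof. by rewrite /pow2N mulrDr opprD expRD. Qed.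

Lemma pow2N_gt0 (t : R) : 0 < pow2N t. Proof. exact: expR_gt0. Qed.

Lemma pow2N_le (s t : R) : s <= t -> pow2N t <= pow2N s.
Proof. by move=> st; rewrite ler_expR lerN2 ler_pM2l// ln2_pos. Qed.

Lemma pow2N0 : pow2N 0 = 1.
Proof. by rewrite /pow2N mulr0 oppr0 expR0. Qed.

Lemma log2_pow2N (t : R) : log2 (pow2N t) = - t.
Proof. by rewrite /log2 /pow2N expRK -mulrN mulrAC divff ?mul1r ?gt_eqF ?ln2_pos. Qed.

Lemma pow2N_log2 (a : R) : 0 < a -> pow2N (- log2 a) = a.
Proof.
move=> a0; rewrite /pow2N /log2 mulrN opprK mulrCA divff ?mulr1 ?gt_eqF ?ln2_pos//.
by rewrite lnK.
Qed.

Lemma pow2N1 : pow2N 1 = 2^-1.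
Proof. by rewrite -[in LHS]log22 -[log2 2]opprK -log2V// pow2N_log2. Qed.

Lemma pow2N_unit_cost (l i : nat) : (0 < l)%N ->
  pow2N (l%:R * unit_cost l i) = run_weight l i / 2.
Proof.
move=> l0; rewrite /unit_cost mulrC divfK ?pnatr_eq0 -?lt0n//.
by rewrite pow2ND pow2N1 pow2N_log2 ?run_weight_gt0// mulrC.
Qed.

(** The k tokens that end at the start at 0 have length l. *)
Definition prevrun (x : full_shift) (l k : nat) : Prop :=
  forall p : nat, (p <= k * l)%N -> is_start x (- p%:Z) = (l %| p)%N.

Lemma prevrun_le (x : full_shift) (l k k' : nat) : (k <= k')%N ->
  prevrun x l k' -> prevrun x l k.
Proof.
move=> kk h p hp; apply: h; apply: leq_trans hp _.
by rewrite leq_mul2r kk orbT.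
Qed.

Lemma run_prevrun (x : full_shift) (l k : nat) :
  run x 0 l k -> prevrun x l k /\ prevrun (iter l shift_map x) l k.+1.
Proof.
rewrite /run add0n => h; split => p hp.
  by rewrite -(@dvdn_addl (l)%N) ?dvdnn// -h; [congr is_start; lia|nia].
by rewrite is_start_iter -h//; congr is_start; lia.
Qed.

Lemma prevrun_shift (x : full_shift) (l k : nat) : run x 0 l 0 ->
  prevrun (iter l shift_map x) l k.+1 <-> prevrun x l k.
Proof.
rewrite /run add0n => h; split => h' p hp.
  rewrite -(@dvdn_addl (l)%N) ?dvdnn// -h'; last by nia.
  by rewrite is_start_iter; congr is_start; lia.
rewrite is_start_iter; have [pl|lp] := leqP p l.
  by rewrite -h; [congr is_start; lia|lia].
rewrite -{2}(subnK (ltnW lp)) dvdn_addl ?dvdnn// -h'; last by nia.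
by congr is_start; lia.
Qed.

Lemma prevrun_uniq (y : full_shift) (l m : nat) : (0 < l)%N -> (0 < m)%N ->
  prevrun y l 1 -> prevrun y m 1 -> l = m.
Proof.
have aux (a b : nat) :
    (0 < a)%N -> (a < b)%N -> prevrun y a 1 -> prevrun y b 1 -> False.
  move=> a0 ab ha hb; have := ha a; rewrite mul1n leqnn dvdnn hb; last by lia.
  by rewrite gtnNdvd// => H; have := H isT.
move=> l0 m0 hl hm; apply/eqP; rewrite eqn_leq; apply/andP; split; rewrite leqNgt;
  apply/negP => lt; [exact: aux lt hm hl|exact: aux lt hl hm].
Qed.

Lemma rate_token (x : full_shift) (l j : nat) : run x 0 l 0 -> (j < l)%N ->
  rate (iter j shift_map x) = rate x :> R.
Proof.
move=> r jl.
have E i : run (iter j shift_map x) j (l - j) i <-> run x 0 l i.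
  by rewrite -{2}(subnKC (ltnW jl)); apply: run_iter.
have e : (j + (l - j))%N = l by lia.
apply/le_anti/andP; split.
  apply: (@rate_ge _ x 0 l) => //; first by lia.
  by move=> i ri; rewrite add0n -[X in unit_cost X]e; apply: rate_le; [lia|apply/E].
apply: (@rate_ge _ _ j (l - j)); [lia|by apply/E|].
by move=> i /E ri; rewrite e; apply: (@rate_le _ x 0 l); [lia|].
Qed.

Definition birkhoff (g : full_shift -> R) (n : nat) (x : full_shift) : R :=
  \sum_(j < n) g (iter j shift_map x).

Lemma birkhoffD (g : full_shift -> R) (m n : nat) (x : full_shift) :
  birkhoff g (m + n) x = birkhoff g m x + birkhoff g n (iter m shift_map x).
Proof.
rewrite /birkhoff big_split_ord /=; congr (_ + _).
by apply: eq_bigr => j _; rewrite addnC iterD.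
Qed.

Lemma birkhoff_ge0 (g : full_shift -> R) (n : nat) (x : full_shift) :
  (forall y, 0 <= g y) -> 0 <= birkhoff g n x.
Proof. by move=> h; apply: sumr_ge0. Qed.

Lemma birkhoff_token (x : full_shift) (l : nat) : run x 0 l 0 ->
  birkhoff rate l x = l%:R * rate x :> R.
Proof.
move=> r; rewrite /birkhoff (eq_bigr (fun=> rate x)).
  by rewrite sumr_const card_ord mulr_natl.
by move=> j _; apply: rate_token r _.
Qed.

(** The state s does not underestimate the repetition that x shows just before
coordinate 0.  Only lengths up to n matter: no other can recur within n symbols. *)
Definition consistent (n : nat) (x : full_shift) (s : parse_state) : Prop :=
  (forall l, (0 < l <= n)%N -> l != s.1 -> ~ prevrun x l 1) /\
  (if s.2 is Some k then (0 < k)%N /\ ~ prevrun x s.1 k.+1 else True).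

(** The rate charges a token at least what the parse charges for it, since the
recorded run is not shorter than the true one. *)
Lemma step_weight_rate (n : nat) (x : full_shift) (s : parse_state) (l : nat) :
  consistent n x s -> (0 < l <= n)%N -> run x 0 l 0 ->
  pow2N (l%:R * rate x) <= step_weight s l / 2.
Proof.
case: s => l' o [/= h1 h2] ln r; have l0 : (0 < l)%N by lia.
have l0R : 0 < l%:R :> R by rewrite ltr0n.
have key (i : nat) : unit_cost l i <= rate x :> R ->
    pow2N (l%:R * rate x) <= run_weight l i / 2.
  by move=> hi; rewrite -pow2N_unit_cost//; apply: pow2N_le; rewrite ler_pM2l.
rewrite /step_weight /=; case: eqP => ll'; last first.
  apply: (key 0%N); apply: (@rate_ge _ x 0 l) => // i ri.
  case: i ri => [//|i] /run_prevrun[/(prevrun_le (isT : 1 <= i.+1)%N) ri _].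
  by case: (h1 l ln _ ri); apply/eqP.
case: o h2 => [k [k0 h2]|_]; last first.
  rewrite div1r -pow2N1; apply: pow2N_le.
  rewrite -ler_pdivrMl// mulr1; apply: (@rate_ge _ x 0 l) => // i _.
  by rewrite add0n unit_cost_ge.
suff /key : unit_cost l k <= rate x :> R by case: (k) k0.
apply: (@rate_ge _ x 0 l) => // i ri; rewrite add0n; apply: unit_cost_le => //.
rewrite leqNgt; apply/negP => ki; apply: h2.
by rewrite -ll'; apply: prevrun_le (run_prevrun ri).1.
Qed.

Lemma consistent_next (n : nat) (x : full_shift) (s : parse_state) (l : nat) :
  consistent n x s -> (0 < l <= n)%N -> run x 0 l 0 ->
  consistent (n - l) (iter l shift_map x) (next_state s l).
Proof.
case: s => l' o [/= h1 h2] ln r; have l0 : (0 < l)%N by lia.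
have [_ r1] := run_prevrun r.
have nx1 : (next_state (l', o) l).1 = l by rewrite /next_state /=; case: eqP.
split.
  rewrite nx1 => m hm ml r2; case/eqP: ml.
  by apply: (prevrun_uniq _ _ r2 r1); lia.
rewrite nx1 /next_state /=; case: eqP => [ll'|/eqP ll'] /=; last first.
  by split=> // /(prevrun_shift _ r); apply: h1.
case: o h2 {nx1} => [k [k0 h2]|] //=; split=> // /(prevrun_shift _ r).
by rewrite ll'.
Qed.

Lemma codes_word (N n : nat) (x : full_shift) (s : parse_state) :
  (n <= N)%N -> is_start x 0 -> consistent n x s ->
  exists c, [/\ c \in codes N n s, c.1 = word x n & pow2N (birkhoff rate n x) <= c.2].
Proof.
elim: N n x s => [|N IH] n x s nN s0 cs.
  exists (token_word (x 1) n, 1); split=> /=.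
  - by rewrite !inE; case: (x 1); rewrite eqxx ?orbT.
  - by rewrite word_token// => j; lia.
  - by rewrite -pow2N0; apply/pow2N_le/birkhoff_ge0/rate_ge0.
have [[j0 hj0]|no] := pselect (exists j, (0 < j <= n)%N && is_start x j%:Z); last first.
  exists (token_word (x 1) n, 1); split=> /=.
  - by rewrite !inE; case: (x 1); rewrite eqxx ?orbT.
  - rewrite word_token// => j jn; apply/negP => sj; apply: no.
    by exists j; rewrite sj; lia.
  - by rewrite -pow2N0; apply/pow2N_le/birkhoff_ge0/rate_ge0.
have [l /andP[ln sl] lmin] :=
  ex_minnP (ex_intro (fun j => (0 < j <= n)%N && is_start x j%:Z) j0 hj0).
have mid j : (0 < j < l)%N -> ~~ is_start x j%:Z.
  by move=> jl; apply/negP => sj; have := lmin j; rewrite sj => H; have := H ltac:(lia); lia.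
have r : run x 0 l 0.
  move=> p; rewrite add0n mul1n => pl.
  have [->|p0] := posnP p; first by rewrite subr0 dvdn0.
  have [->|pl'] := eqVneq p l; first by rewrite subrr dvdnn.
  rewrite gtnNdvd//; last by lia.
  rewrite (_ : _ - _ = (l - p)%N%:Z); last by lia.
  by apply/negbTE/mid; lia.
have := IH (n - l)%N (iter l shift_map x) (next_state s l) ltac:(lia) _ (consistent_next cs ln r).
case; first by rewrite is_start_iter add0r.
move=> c [cin cw cp].
exists (token_word (x 1) l ++ c.1, step_weight s l / 2 * c.2); split => /=.
- rewrite !inE; apply/orP; right; apply/orP; right; apply/flattenP.
  exists [seq (token_word (x 1) l ++ d.1, step_weight s l / 2 * d.2)
         | d <- codes N (n - l) (next_state s l)].
    apply/mapP; exists (l, x 1) => //; exact: mem_token_shapes.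
  by apply/mapP; exists c.
- by rewrite cw -word_token// -word_cat subnKC//; lia.
- rewrite -[in X in pow2N X](@subnKC l n); last by lia.
  rewrite birkhoffD pow2ND birkhoff_token//.
  apply: ler_pM; rewrite ?(ltW (pow2N_gt0 _))//.
  exact: step_weight_rate cs ln r.
Qed.

Definition window_shapes (n : nat) : seq (nat * bool * nat) :=
  [seq (p, l) | p <- [seq (d, b) | d <- iota 0 n, b <- [:: false; true]],
                l <- iota 0 n.+1].

Lemma mem_window_shapes (n d l : nat) (b : bool) :
  (d < n)%N -> (l <= n)%N -> ((d, b), l) \in window_shapes n.
Proof.
move=> dn ln; apply: (@allpairs_f _ _ _ pair); last by rewrite mem_iota; lia.
apply: (@allpairs_f _ _ _ pair); first by rewrite mem_iota.
by rewrite !inE; case: b.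
Qed.

(** A window that need not begin at a start: the position of its first start and the
length of the token that ends there are guessed, and the run to which this token
belongs is left unrecorded.  The guess 0 stands for the lengths above n. *)
Definition window_codes (n : nat) : seq (seq bool * R) :=
  [seq (gap_word b n, 1) | b <- [:: false; true]] ++
  flatten [seq [seq (gap_word t.1.2 t.1.1 ++ c.1, c.2)
               | c <- codes n (n - t.1.1) (t.2, None)]
          | t <- window_shapes n].

Lemma window_codes_ge0 (n : nat) c : c \in window_codes n -> 0 <= c.2.
Proof.
rewrite !inE => /orP[/eqP -> //|/orP[/eqP -> //|]].
by case/flattenP => L /mapP[t _ ->] /mapP[d hd -> /=]; exact: codes_ge0 hd.
Qed.

Lemma window_codes_mass (n : nat) : mass (window_codes n) <= 4 * (n%:R + 1) ^+ 4.
Proof.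
rewrite /mass /= !big_cons big_flatten /= big_map.
apply: le_trans (_ : 1 + (1 + \sum_(t <- window_shapes n) 2 * (n%:R + 1) ^+ 2) <= _).
  rewrite !lerD2l; apply: ler_sum => t _; rewrite big_map /=.
  apply: le_trans (mass_le n (n - t.1.1) (t.2, None)) _.
  exact: (@mass_bound_le _ n None (leq_subr _ _)).
rewrite big_const_seq count_predT /window_shapes !size_allpairs /= !size_iota iter_addr_0.
rewrite -[_ *+ (n * 2 * n.+1)]mulr_natl !natrM -natr1.
have n0 : 0 <= n%:R :> R by [].
rewrite !exprS expr0; nra.
Qed.

Lemma window_codes_word (n : nat) (x : full_shift) :
  exists c, [/\ c \in window_codes n, c.1 = word x n & pow2N (birkhoff rate n x) <= c.2].
Proof.
have [[j0 hj0]|no] := pselect (exists j, (j < n)%N && is_start x j%:Z); last first.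
  exists (gap_word (x 0) n, 1); split=> /=.
  - by rewrite !inE; case: (x 0); rewrite eqxx ?orbT.
  - rewrite word_no_start// => j jn; apply/negP => sj; apply: no.
    by exists j; rewrite sj jn.
  - by rewrite -pow2N0; apply/pow2N_le/birkhoff_ge0/rate_ge0.
have [d /andP[dn sd] dmin] :=
  ex_minnP (ex_intro (fun j => (j < n)%N && is_start x j%:Z) j0 hj0).
have mid j : (j < d)%N -> ~~ is_start x j%:Z.
  by move=> jl; apply/negP => sj; have := dmin j; rewrite sj => H; have := H ltac:(lia); lia.
set y := iter d shift_map x.
(* a token of length more than n that ends at d is never repeated in the window *)
have [l' [l'n hl']] : exists l', (l' <= n)%N /\ consistent (n - d) y (l', None).
  have [[l' [l'n r']]|no] := pselect (exists l', (0 < l' <= n)%N /\ prevrun y l' 1).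
    exists l'; split; first by lia.
    by split => //= l ln ll' r; case/eqP: ll'; apply: (prevrun_uniq _ _ r r'); lia.
  exists 0%N; split => //; split => //= l ln _ r; apply: no; exists l; split => //.
  by lia.
have s0 : is_start y 0 by rewrite is_start_iter add0r.
have [c [cin cw cp]] := codes_word (leq_subr d n) s0 hl'.
exists (gap_word (x 0) d ++ c.1, c.2); split => /=.
- rewrite !inE; apply/orP; right; apply/orP; right; apply/flattenP.
  exists [seq (gap_word (x 0) d ++ e.1, e.2) | e <- codes n (n - d) (l', None)].
    by apply/mapP; exists ((d, x 0), l') => //; apply: mem_window_shapes.
  by apply/mapP; exists c.
- by rewrite cw -word_no_start// -word_cat subnKC//; lia.
- rewrite -[in X in pow2N X](@subnKC d n); last by lia.
  apply: le_trans cp; apply: pow2N_le; rewrite birkhoffD lerDr.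
  by apply: birkhoff_ge0 => z; exact: rate_ge0.
Qed.

(** The number of bits lost to the normalization of the codes is subexponential. *)
Lemma log2_window_mass (e : R) : 0 < e -> exists C : R, 0 <= C /\
  forall n : nat, log2 (4 * (n%:R + 1) ^+ 4) <= e * n%:R + C.
Proof.
move=> e0; have [C [C0 hC]] := log2_le_affine (ltac:(lra) : 0 < e / 4).
exists (2 + e + 4 * C); split; first by lra.
move=> n; have n1 : 0 < n%:R + 1 :> R by rewrite ltr_wpDl.
have h := hC _ n1.
have -> : 4 * (n%:R + 1) ^+ 4 =
    2 * (2 * ((n%:R + 1) * ((n%:R + 1) * ((n%:R + 1) * (n%:R + 1))))) :> R.
  by ring.
by rewrite !log2M ?mulr_gt0// log22; lra.
Qed.

End codes.

(** * Window sets, continuity and measurability *)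

Lemma agree_open (M : nat) (x : full_shift) : open (agree M x).
Proof.
have op (p : int) : open [set y : full_shift | y p = x p].
  have pc : continuous (fun y : full_shift => y p : bool).
    by move=> y; exact: (@proj_continuous int (fun=> bool) p y).
  by move/continuousP : pc => /(_ [set x p] (discrete_open _)).
elim: M => [|M IH].
  rewrite (_ : agree 0 x = [set y | y 0 = x 0])//; apply/seteqP; split => y /=.
    by move=> ->.
  by move=> h p; rewrite leqn0 absz_eq0 => /eqP ->.
rewrite (_ : agree M.+1 x = agree M x `&` [set y | y M.+1%:Z = x M.+1%:Z]
    `&` [set y | y (- M.+1%:Z) = x (- M.+1%:Z)]).
  by apply: openI; [apply: openI|].
apply/seteqP; split => y /=.
  by move=> h; split; [split; [move=> p hp|]|]; rewrite h//; lia.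
move=> [[h1 h2] h3] p hp.
have [pM|Mp] := leqP `|p| M; first exact: h1.
have [->|->] : p = M.+1%:Z \/ p = - M.+1%:Z by lia.
  by [].
by [].
Qed.

Lemma agree_nbhs (M : nat) (x : full_shift) : nbhs x (agree M x).
Proof. by apply: open_nbhs_nbhs; split; [exact: agree_open|]. Qed.

(** Otherwise points outside A that agree with x on ever larger windows would
converge to x. *)
Lemma open_agree (A : set full_shift) (x : full_shift) : open A -> A x ->
  exists M, agree M x `<=` A.
Proof.
move=> oA Ax; apply: contrapT => /forallNP no.
have /choice[u hu] : forall M, exists y, agree M x y /\ ~ A y.
  move=> M; apply: contrapT => h; apply: (no M) => y xy.
  by apply: contrapT => nAy; apply: h; exists y.
have ux : u @ \oo --> x.
  apply/cvg_sup => p B /=.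
  have -> := @nbhsE (initial_topology (fun f : full_shift => f p)) x.
  move=> -[C [[D oD <-] Dx] CB].
  exists `|p|%N => // n /= pn; apply: CB => /=.
  by rewrite -(proj1 (hu n)).
have /ux : nbhs x A by apply: open_nbhs_nbhs.
by move=> [n _ /(_ n (leqnn n))] /=; case: (hu n).
Qed.
Definition window_set (M : nat) (A : set full_shift) : Prop :=
  forall x y, agree M x y -> A x -> A y.

Lemma window_set_open (M : nat) (A : set full_shift) : window_set M A -> open A.
Proof.
move=> h; rewrite openE => x Ax.
by apply: filterS (agree_nbhs M x) => y xy; exact: h xy Ax.
Qed.

Lemma open_borel (A : set full_shift) : open A -> measurable (A : set borel_full_shift).
Proof. by move=> oA; exact: sub_sigma_algebra. Qed.

Lemma window_set_measurable (M : nat) (A : set borel_full_shift) :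
  window_set M A -> measurable A.
Proof. by move=> h; exact: (open_borel (window_set_open h)). Qed.

Lemma continuous_window (T : topologicalType) (g : full_shift -> T) :
  (forall x (B : set T), nbhs (g x) B ->
     exists M, forall y, agree M x y -> B (g y)) -> continuous g.
Proof.
move=> h x B /h[M hM].
by apply: filterS (agree_nbhs M x) => y /hM.
Qed.

Lemma agree_le (M M' : nat) (x y : full_shift) : (M <= M')%N ->
  agree M' x y -> agree M x y.
Proof. by move=> MM h p hp; apply: h; apply: leq_trans MM. Qed.

Lemma agree_iter (j M M' : nat) (x y : full_shift) : (M + j <= M')%N ->
  agree M' x y -> agree M (iter j shift_map x) (iter j shift_map y).
Proof. by move=> MM h p hp; rewrite !iter_shiftE; apply: h; lia. Qed.

Lemma measurable_of_open (S : borel_full_shift -> borel_full_shift) :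
  (forall A : set full_shift, open A -> open (S @^-1` A : set full_shift)) ->
  measurable_fun setT S.
Proof.
move=> h.
apply: (@measurability _ _ borel_full_shift borel_full_shift setT S
  (@open full_shift)) => //.
by move=> _ [A oA <-]; rewrite setTI; exact: (open_borel (h _ oA)).
Qed.

Lemma iter_shift_measurable (j : nat) :
  measurable_fun setT (iter j shift_map : borel_full_shift -> borel_full_shift).
Proof.
apply: measurable_of_open => A oA; rewrite openE => x Ax.
have [M hM] := open_agree oA Ax.
apply: filterS (agree_nbhs (M + j) x) => y xy; apply: hM.
exact: agree_iter xy.
Qed.

Section real_functions.
Context {R : realType}.

Lemma continuous_borel (g : full_shift -> R) : continuous g ->
  measurable_fun setT (g : borel_full_shift -> R).
Proof.
move=> /continuousP cg.
apply: (@measurability _ _ borel_full_shift _ setT g _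
  (measurable_realfun.RGenOpens.measurableE R)).
move=> _ [_ [a [b ->]] <-]; rewrite setTI; apply: open_borel; apply: cg.
exact: interval_open.
Qed.

Lemma rate_continuous : continuous (rate : full_shift -> R).
Proof.
apply: continuous_window => x B /nbhs_ballP[e /= e0 eB].
have [M hM] := @rate_window R (e / 2) ltac:(by rewrite divr_gt0).
exists M => y xy; apply: eB; rewrite /ball /= ltr_norml.
have := hM _ _ xy; have := hM _ _ (agree_sym xy); move=> h1 h2.
by apply/andP; split; lra.
Qed.

Lemma rate_bounded : exists C : R, forall x, rate x <= C.
Proof.
have [C [C0 hC]] := @unit_cost_sublinear R 1 ltr01.
exists (1 + C) => x.
have [[a [b [b0 r]]]|nr] := pselect (exists a b, (0 < b)%N /\ run x a b 0); last first.
  rewrite rate_no_run ?addr_ge0// => a b b0 r.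
  by apply: nr; exists a, b.
have ab0 : (0 < a + b)%N by lia.
apply: le_trans (rate_le b0 r) _; apply: le_trans (hC _ _ ab0) _.
by rewrite lerD2l ler_piMr// invf_le1 ?ltr0n// ler1n.
Qed.

End real_functions.

(** * Means of bounded functions *)

Section mean.
Context {d : measure_display} {T : measurableType d} {R : realType}.
Implicit Types (mu : probability T R) (g h : T -> R) (A B : set T).

Definition bounded_measurable g : Prop :=
  measurable_fun setT g /\ exists C : R, forall x, `|g x| <= C.

Definition mean mu g : R := (\int[mu]_x g x)%R.

Definition prob mu A : R := fine (mu A).

Lemma bmD g h : bounded_measurable g -> bounded_measurable h ->
  bounded_measurable (fun x => g x + h x).
Proof.
move=> [mg [C hC]] [mh [C' hC']]; split; first exact: measurable_funD.
by exists (C + C') => x; apply: le_trans (ler_normD _ _) _; exact: lerD.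
Qed.

Lemma bmZ (r : R) g : bounded_measurable g -> bounded_measurable (fun x => r * g x).
Proof.
move=> [mg [C hC]]; split; first exact: measurable_funM.
by exists (`|r| * C) => x; rewrite normrM ler_wpM2l.
Qed.

Lemma bm_cst (r : R) : bounded_measurable (fun=> r).
Proof. by split; [exact: measurable_cst|exists `|r|]. Qed.

Lemma bm_sum (I : Type) (s : seq I) (F : I -> T -> R) :
  (forall i, bounded_measurable (F i)) ->
  bounded_measurable (fun x => \sum_(i <- s) F i x).
Proof.
move=> h; elim: s => [|i s IH].
  by under eq_fun do rewrite big_nil; exact: bm_cst.
by under eq_fun do rewrite big_cons; apply: bmD.
Qed.

Lemma bm_indic A : measurable A -> bounded_measurable (\1_A : T -> R).
Proof.
move=> mA; split; first exact: measurable_indic.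
by exists 1 => x; rewrite indicE; case: (_ \in _); rewrite ?normr1 ?normr0.
Qed.

Lemma bm_integrable mu g : bounded_measurable g ->
  mu.-integrable setT (EFin \o g).
Proof.
move=> [mg [C hC]]; apply: measurable_bounded_integrable => //.
  by rewrite ltey_eq fin_num_measure.
by exists C; split=> [|M CM x _]; [exact: num_real|exact: le_trans (hC x) (ltW CM)].
Qed.

Lemma meanE mu g : bounded_measurable g -> (\int[mu]_x (g x)%:E)%E = (mean mu g)%:E.
Proof.
move=> bg; rewrite /mean /Rintegral fineK//.
exact: (@integrable_fin_num _ _ _ mu setT measurableT _ (bm_integrable mu bg)).
Qed.

Lemma meanD mu g h : bounded_measurable g -> bounded_measurable h ->
  mean mu (fun x => g x + h x) = mean mu g + mean mu h.
Proof. by move=> bg bh; rewrite /mean RintegralD//; exact: bm_integrable. Qed.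

Lemma meanZ mu (r : R) g : bounded_measurable g ->
  mean mu (fun x => r * g x) = r * mean mu g.
Proof. by move=> bg; rewrite /mean RintegralZl//; exact: bm_integrable. Qed.

Lemma mean_cst mu (r : R) : mean mu (fun=> r) = r.
Proof.
rewrite /mean Rintegral_cst//.
etransitivity; last exact: mulr1.
by congr (r * _); exact: (congr1 fine (probability_setT mu)).
Qed.

Lemma mean_le mu g h : bounded_measurable g -> bounded_measurable h ->
  (forall x, g x <= h x) -> mean mu g <= mean mu h.
Proof. by move=> bg bh gh; apply: le_Rintegral => //; exact: bm_integrable. Qed.

Lemma mean_sum mu (I : Type) (s : seq I) (F : I -> T -> R) :
  (forall i, bounded_measurable (F i)) ->
  mean mu (fun x => \sum_(i <- s) F i x) = \sum_(i <- s) mean mu (F i).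
Proof.
move=> h; elim: s => [|i s IH].
  by under [X in mean _ X]eq_fun do rewrite big_nil; rewrite mean_cst big_nil.
under [X in mean _ X]eq_fun do rewrite big_cons.
by rewrite meanD ?IH ?big_cons//; exact: bm_sum.
Qed.

Lemma mean_indic mu A : measurable A -> mean mu (\1_A) = prob mu A.
Proof. by move=> mA; rewrite /mean /Rintegral integral_indic// setIT. Qed.

Lemma probE mu A : measurable A -> mu A = (prob mu A)%:E.
Proof. by move=> mA; rewrite /prob fineK// fin_num_measure. Qed.

Lemma prob_ge0 mu A : 0 <= prob mu A.
Proof. by rewrite /prob fine_ge0. Qed.

Lemma prob_le mu A B : measurable A -> measurable B -> A `<=` B -> prob mu A <= prob mu B.
Proof.
by move=> mA mB AB; rewrite -lee_fin -!probE//; apply: le_measure; rewrite ?inE.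
Qed.

Lemma probU mu A B : measurable A -> measurable B ->
  prob mu (A `|` B) <= prob mu A + prob mu B.
Proof.
move=> mA mB; rewrite -lee_fin EFinD -!probE//; last exact: measurableU.
exact: measureU2.
Qed.

Lemma prob_bigU mu (n : nat) (F : nat -> set T) : (forall i, measurable (F i)) ->
  prob mu (\big[setU/set0]_(i < n) F i) <= \sum_(i < n) prob mu (F i).
Proof.
move=> mF; elim: n => [|n IH]; first by rewrite !big_ord0 /prob measure0.
rewrite !big_ord_recr /=; apply: le_trans (probU _ _ _) _ => //.
  exact: bigsetU_measurable.
by rewrite lerD2r.
Qed.

Lemma probD mu A B : measurable A -> measurable B -> A `<=` B ->
  prob mu (B `\` A) = prob mu B - prob mu A.
Proof.
move=> mA mB AB; apply/EFin_inj; rewrite EFinB -!probE//; last exact: measurableD.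
rewrite measureD//= ?setIidr//.
by rewrite -ge0_fin_numE// fin_num_measure.
Qed.

Lemma mean_pushforward mu (phi : T -> T) g :
  measurable_fun setT phi -> (forall A, measurable A -> mu (phi @^-1` A) = mu A) ->
  bounded_measurable g -> mean mu (g \o phi) = mean mu g.
Proof.
move=> mphi inv [mg bg]; rewrite /mean /Rintegral; congr fine.
rewrite -(@integral_pushforward _ _ _ _ _ _ mphi mu setT (EFin \o g))//; last 2 first.
- exact/measurable_EFinP.
- rewrite preimage_setT; apply: (@bm_integrable mu (g \o phi)); split.
    exact: measurableT_comp.
  by case: bg => C hC; exists C => x; exact: hC.
by apply: eq_measure_integral => A mA _; exact: inv.
Qed.

End mean.

Section invariant.
Context {R : realType}.
Local Notation X := borel_full_shift.
Variable mu : probability X R.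
Hypothesis inv : shift_invariant mu.

Lemma invariant_iter (j : nat) (A : set X) : measurable A ->
  mu (iter j shift_map @^-1` A) = mu A.
Proof.
move=> mA; elim: j => [//|j IH]; rewrite -[RHS]IH.
have -> : iter j.+1 shift_map @^-1` A = shift_map @^-1` (iter j shift_map @^-1` A).
  by apply/seteqP; split => x /=; rewrite -iterSr.
apply: inv; rewrite -[X in measurable X]setTI.
exact: iter_shift_measurable.
Qed.

Lemma bm_iter (j : nat) (g : X -> R) : bounded_measurable g ->
  bounded_measurable (fun x : X => g (iter j shift_map x)).
Proof.
move=> [mg [C hC]]; split; last by exists C.
exact: (measurableT_comp mg (iter_shift_measurable j)).
Qed.

Lemma mean_iter (j : nat) (g : X -> R) : bounded_measurable g ->
  mean mu (fun x : X => g (iter j shift_map x)) = mean mu g.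
Proof.
move=> bg; apply: (mean_pushforward (iter_shift_measurable j)) => //.
exact: invariant_iter.
Qed.

Lemma bm_birkhoff (n : nat) (g : X -> R) : bounded_measurable g ->
  bounded_measurable (birkhoff g n : X -> R).
Proof. by move=> bg; apply: bm_sum => j; exact: bm_iter. Qed.

Lemma mean_birkhoff (n : nat) (g : X -> R) : bounded_measurable g ->
  mean mu (birkhoff g n) = n%:R * mean mu g.
Proof.
move=> bg; rewrite /birkhoff mean_sum; last by move=> j; exact: bm_iter.
rewrite (eq_bigr (fun=> mean mu g)); last by move=> j _; exact: mean_iter.
by rewrite sumr_const card_ord mulr_natl.
Qed.

Lemma bm_rate : bounded_measurable (rate : X -> R).
Proof.
split; first by apply: continuous_borel; exact: rate_continuous.
have [C hC] := @rate_bounded R; exists C => x.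
by rewrite ger0_norm ?rate_ge0.
Qed.

Lemma mean_rate_ge0 : 0 <= mean mu rate.
Proof.
rewrite -[leLHS](mean_cst mu).
by apply: mean_le => //; [exact: bm_cst|exact: bm_rate|exact: rate_ge0].
Qed.

End invariant.

(** * Gibbs' inequality *)

Section gibbs.
Context {R : realType}.
Local Notation X := borel_full_shift.
Variables (mu : probability X R) (k : nat) (xi : X -> 'I_k).
Hypothesis mxi : measurable_labelling xi.
Variable n : nat.

Definition itinerary (x : X) : {ffun 'I_n -> 'I_k} :=
  [ffun j : 'I_n => xi (iter j shift_map x)].

Lemma join_cellE (w : {ffun 'I_n -> 'I_k}) :
  join_cell xi w = [set x | itinerary x = w].
Proof.
apply/seteqP; split => x /=; first by move=> h; apply/ffunP => j; rewrite ffunE.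
by move=> <- j; rewrite ffunE.
Qed.

Lemma join_cell_measurable (w : {ffun 'I_n -> 'I_k}) : measurable (join_cell xi w).
Proof.
have -> : join_cell xi w =
    \bigcap_(j in [set: 'I_n]) (iter j shift_map @^-1` (xi @^-1` [set w j])).
  apply/seteqP; split => x /=; first by move=> h j _; exact: h.
  by move=> h j; exact: h.
apply: fin_bigcap_measurable => // j _; rewrite -[X in measurable X]setTI.
by apply: iter_shift_measurable => //; exact: mxi.
Qed.

Lemma itinerary_sum (c : {ffun 'I_n -> 'I_k} -> R) (x : X) :
  c (itinerary x) = \sum_v c v * \1_(join_cell xi v) x.
Proof.
rewrite (bigD1 (itinerary x))//= indicE mem_set ?mulr1; last by rewrite join_cellE.
rewrite big1 ?addr0// => v vx; rewrite indicE memNset ?mulr0// join_cellE => /esym/eqP.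
exact/negP.
Qed.

Lemma bm_itinerary (c : {ffun 'I_n -> 'I_k} -> R) :
  bounded_measurable (fun x => c (itinerary x)).
Proof.
under eq_fun do rewrite itinerary_sum.
by apply: bm_sum => v; apply: bmZ; apply: bm_indic; exact: join_cell_measurable.
Qed.

Lemma mean_itinerary (c : {ffun 'I_n -> 'I_k} -> R) :
  mean mu (fun x => c (itinerary x)) = \sum_v c v * prob mu (join_cell xi v).
Proof.
under [X in mean _ X]eq_fun do rewrite itinerary_sum.
rewrite mean_sum; last by move=> v; apply: bmZ; apply: bm_indic; exact: join_cell_measurable.
apply: eq_bigr => v _; rewrite meanZ ?mean_indic//.
  exact: join_cell_measurable.
by apply: bm_indic; exact: join_cell_measurable.
Qed.

Lemma sum_join_cell :
  \sum_(v : {ffun 'I_n -> 'I_k}) prob mu (join_cell xi v) = 1.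
Proof.
rewrite -[RHS](mean_cst mu) (mean_itinerary (fun=> 1)).
by apply: eq_bigr => v _; rewrite mul1r.
Qed.

(** Summing ln q <= q - 1 at the ratios of the normalized weights to the cell
probabilities shows that entropy is at most the mean code length.  The length
only has to be bounded by a function G of the point, which need not be constant
on cells. *)
Lemma gibbs_inequality (rho : {ffun 'I_n -> 'I_k} -> R) (G : X -> R) (Z : R) :
  (forall v, 0 <= rho v) -> \sum_v rho v <= Z -> 0 < Z -> bounded_measurable G ->
  (forall x, pow2N (G x) <= rho (itinerary x)) ->
  join_entropy mu xi n <= mean mu G + log2 Z.
Proof.
move=> rho0 rhoZ Z0 bG hG.
have ln20 := @ln2_pos R.
set p := fun v : {ffun 'I_n -> 'I_k} => prob mu (join_cell xi v).
have p0 v : 0 <= p v by exact: prob_ge0.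
have step v : - (p v * log2 (p v)) <=
    (- log2 (rho v)) * p v + (log2 Z * p v + (rho v / Z - p v) / ln 2).
  have [pv|pv] := eqVneq (p v) 0.
    rewrite pv !(mul0r, mulr0, oppr0, add0r, addr0).
    by apply: divr_ge0 (ltW ln20); apply: divr_ge0 (ltW Z0).
  have {}pv : 0 < p v by rewrite lt_def pv; exact: p0.
  have [x vx] : join_cell xi v !=set0.
    apply/set0P; apply/eqP => e; move: pv.
    by rewrite /p /prob e measure0 ltxx.
  have rv : 0 < rho v.
    apply: lt_le_trans (pow2N_gt0 (G x)) _; move: vx; rewrite join_cellE /= => <-.
    exact: hG.
  have q0 : 0 < rho v / Z / p v by rewrite !divr_gt0.
  have := @le_ln1Dx R (rho v / Z / p v - 1) ltac:(lra).
  rewrite addrC subrK !ln_div ?posrE ?divr_gt0// /log2 => h.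
  have {h} := ler_wpM2r (ltW pv) h; rewrite [X in _ <= X]mulrBl divfK ?gt_eqF// mul1r => h.
  rewrite -subr_ge0 (_ : _ - _ =
    ((rho v / Z - p v) - (ln (rho v) - ln Z - ln (p v)) * p v) / ln 2).
    by rewrite divr_ge0 ?(ltW ln20)// subr_ge0.
  by field; rewrite !gt_eqF.
have : join_entropy mu xi n <= \sum_v ((- log2 (rho v)) * p v +
    (log2 Z * p v + (rho v / Z - p v) / ln 2)).
  by apply: ler_sum => v _; exact: step.
move/le_trans; apply; rewrite !big_split /= -(mean_itinerary (fun v => - log2 (rho v))).
apply: lerD; first apply: mean_le => //.
- exact: (bm_itinerary (fun v => - log2 (rho v))).
- move=> x; rewrite lerNl -log2_pow2N; apply: log2_le; first exact: pow2N_gt0.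
  exact: hG.
- rewrite -mulr_sumr sum_join_cell mulr1 gerDl -mulr_suml mulr_le0_ge0//.
    by rewrite big_split /= -mulr_suml sumrN sum_join_cell subr_le0 ler_pdivrMr// mul1r.
  by rewrite invr_ge0 ltW.
Qed.

End gibbs.

(** * Approximation by window sets *)

Section approximation.
Context {R : realType}.
Local Notation X := borel_full_shift.
Variable mu : probability X R.
Implicit Types (A B : set X).

Definition symdiff A B : set X := (A `\` B) `|` (B `\` A).

Definition approximable A : Prop := measurable A /\
  forall e : R, 0 < e ->
    exists M B, window_set M B /\ prob mu (symdiff A B) < e.

Lemma symdiff_measurable A B : measurable A -> measurable B ->
  measurable (symdiff A B).
Proof. by move=> mA mB; apply: measurableU; apply: measurableD. Qed.

Lemma approximable_open (A : set full_shift) : open A -> approximable A.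
Proof.
move=> oA; split; first exact: open_borel.
move=> e e0.
pose F M : set X := [set x | agree M x `<=` A].
have wF M : window_set M (F M).
  move=> x y xy Fx z yz; apply: Fx => p hp.
  by rewrite xy// yz.
have mF M : measurable (F M) := window_set_measurable (wF M).
have UF : \bigcup_M F M = A.
  apply/seteqP; split => x /=; first by move=> [M _]; apply.
  by move=> Ax; have [M hM] := open_agree oA Ax; exists M.
have ndF : nondecreasing_seq F.
  move=> m n mn; apply/subsetPset => x Fx z xz; apply: Fx.
  exact: agree_le xz.
have mA := open_borel oA.
have : (fun M => mu (F M)) @ \oo --> (prob mu A)%:E.
  rewrite -probE//.
  have := nondecreasing_cvg_mu mF (_ : measurable (\bigcup_M F M)) ndF (mu := mu).
  by rewrite UF => /(_ mA).
move=> /fine_cvgP[_ /cvgrPdist_lt/(_ e e0)].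
case=> M _ /(_ M (leqnn M)) /= h.
exists M, (F M); split; first exact: wF.
have FA : F M `<=` A by rewrite -UF; exact: bigcup_sup.
rewrite /symdiff (_ : F M `\` A = set0) ?setU0; last by rewrite setD_eq0.
rewrite probD//.
by apply: le_lt_trans h; exact: ler_norm.
Qed.

Lemma approximableC A : approximable A -> approximable (~` A).
Proof.
move=> [mA hA]; split; first exact: measurableC.
move=> e /hA[M [B [wB h]]]; exists M, (~` B); split.
  by move=> x y xy /= nBx By; apply: nBx; exact: (wB _ _ (agree_sym xy)).
rewrite (_ : symdiff _ _ = symdiff A B)//; rewrite /symdiff.
by apply/seteqP; split => x /=; have [?|?] := pselect (A x);
  have [?|?] := pselect (B x); tauto.
Qed.

Lemma approximableU (F : (set X)^nat) : (forall n, approximable (F n)) ->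
  approximable (\bigcup_n F n).
Proof.
move=> hF; have mF n : measurable (F n) := (hF n).1.
have mU : measurable (\bigcup_n F n) by exact: bigcup_measurable.
split => // e e0.
pose U n := \big[setU/set0]_(i < n) F i.
have mUn n : measurable (U n) by exact: bigsetU_measurable.
have UU : \bigcup_n U n = \bigcup_n F n.
  rewrite /U; apply/seteqP; split => x.
    by move=> [n _]; rewrite -bigcup_mkord => -[i _ Fx]; exists i.
  by move=> [n _ Fx]; exists n.+1 => //; rewrite -bigcup_mkord; exists n => /=.
have ndU : nondecreasing_seq U.
  move=> m n mn; apply/subsetPset => x; rewrite /U -!bigcup_mkord => -[i /= im Fx].
  by exists i => //=; exact: leq_trans mn.
have : (fun n => mu (U n)) @ \oo --> (prob mu (\bigcup_n F n))%:E.
  rewrite -probE//.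
  have := nondecreasing_cvg_mu mUn (_ : measurable (\bigcup_n U n)) ndU (mu := mu).
  by rewrite UU => /(_ mU).
move=> /fine_cvgP[_ /cvgrPdist_lt/(_ (e / 2) ltac:(lra))].
case=> n _ /(_ n (leqnn n)) /= hn.
have n1 : 0 < n.+1%:R :> R by rewrite ltr0n.
have e1 : 0 < e / 2 / n.+1%:R by rewrite !divr_gt0.
have /choice[MB hMB] : forall i, exists MB : nat * set X,
    window_set MB.1 MB.2 /\ prob mu (symdiff (F i) MB.2) < e / 2 / n.+1%:R.
  by move=> i; have [M [B [wB hB]]] := (hF i).2 _ e1; exists (M, B).
pose M := (\max_(i < n) (MB i).1)%N.
pose B := \big[setU/set0]_(i < n) (MB i).2.
have BE : B = \bigcup_(i in [set j | (j < n)%N]) (MB i).2.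
  by rewrite /B -(bigcup_mkord n (fun i => (MB i).2)).
have wB : window_set M B.
  move=> x y xy; rewrite BE => -[i /= ni Bx]; exists i => //=.
  apply: (proj1 (hMB i)) Bx; apply: agree_le xy.
  exact: (@leq_bigmax _ (fun j : 'I_n => (MB j).1) (Ordinal ni)).
have mBi i : measurable (MB i).2 := window_set_measurable (proj1 (hMB i)).
have mB : measurable B := window_set_measurable wB.
exists M, B; split => //.
have mS i : measurable (symdiff (F i) (MB i).2) by exact: symdiff_measurable.
apply: le_lt_trans (_ : _ <= prob mu (\bigcup_n F n `\` U n) +
    prob mu (\big[setU/set0]_(i < n) symdiff (F i) (MB i).2)) _.
  apply: le_trans (probU mu (measurableD mU (mUn n)) (bigsetU_measurable _ _)) => //.
  apply: prob_le => //.
  - exact: symdiff_measurable.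
  - by apply: measurableU; [exact: measurableD|exact: bigsetU_measurable].
  move=> x; rewrite /U BE -(bigcup_mkord n (fun i => symdiff (F i) (MB i).2)).
  rewrite -bigcup_mkord => -[[Fx nBx]|[[i /= ni Bx] nFx]].
    have [[i /= ni Fix]|nUx] := pselect ((\bigcup_(i in [set j | (j < n)%N]) F i) x).
      right; exists i => //; left; split => // Bix; apply: nBx; by exists i.
    by left.
  right; exists i => //; right; split => // Fix; apply: nFx; by exists i.
have h1 : prob mu (\bigcup_n F n `\` U n) < e / 2.
  rewrite probD//; last by rewrite -UU; exact: bigcup_sup.
  by apply: le_lt_trans hn; exact: ler_norm.
have h2 : prob mu (\big[setU/set0]_(i < n) symdiff (F i) (MB i).2) <= e / 2.
  apply: le_trans (prob_bigU _ _ mS) _.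
  apply: le_trans (_ : \sum_(i < n) (e / 2 / n.+1%:R) <= _).
    by apply: ler_sum => i _; exact: ltW (proj2 (hMB i)).
  rewrite sumr_const card_ord -[_ *+ n]mulr_natl mulrCA.
  by rewrite ler_piMr ?ler_pdivrMr// ?mul1r ?ler_nat//; lra.
lra.
Qed.

(** The approximable sets form a sigma-algebra that contains the open sets. *)
Lemma measurable_approximable A : measurable A -> approximable A.
Proof.
move: A; apply: smallest_sub; last by move=> A; exact: approximable_open.
split.
- by apply: approximable_open; exact: open0.
- by move=> A hA; rewrite setTD; exact: approximableC.
- exact: approximableU.
Qed.

(** Approximate each cell of xi by a window set and label x by any of these sets
that contains it. *)
Lemma window_labelling (k : nat) (xi : X -> 'I_k) (e : R) :
  measurable_labelling xi -> 0 < e ->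
  exists M (zeta : X -> 'I_k),
    [/\ (forall x y, agree M x y -> zeta x = zeta y),
        measurable [set x | zeta x != xi x] &
        prob mu [set x | zeta x != xi x] <= e].
Proof.
move=> mxi e0; have k1 : 0 < k.+1%:R :> R by rewrite ltr0n.
have e1 : 0 < e / k.+1%:R by rewrite divr_gt0.
have /choice[MB hMB] : forall i : 'I_k, exists MB : nat * set X,
    window_set MB.1 MB.2 /\ prob mu (symdiff (xi @^-1` [set i]) MB.2) < e / k.+1%:R.
  by move=> i; have [M [B [wB hB]]] := (measurable_approximable (mxi i)).2 _ e1; exists (M, B).
pose M := (\max_i (MB i).1)%N.
pose zeta (x : X) := odflt (xi point) [pick i | `[< (MB i).2 x >]].
have wzeta x y : agree M x y -> zeta x = zeta y.
  move=> xy; rewrite /zeta; congr odflt; apply: eq_pick => i /=.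
  have xyi : agree (MB i).1 x y by apply: agree_le xy; exact: leq_bigmax.
  apply/asboolP/asboolP; apply: (proj1 (hMB i)) => //; exact: agree_sym.
have mBi i : measurable (MB i).2 := window_set_measurable (proj1 (hMB i)).
have mS i : measurable (symdiff (xi @^-1` [set i]) (MB i).2).
  by apply: symdiff_measurable => //; exact: mxi.
have mz i : measurable (zeta @^-1` [set i]).
  apply: (@window_set_measurable M) => x y xy /= <-.
  by apply: wzeta; exact: agree_sym.
have mbad : measurable [set x | zeta x != xi x].
  have -> : [set x | zeta x != xi x] = ~` \bigcup_(i in [set: 'I_k])
      (zeta @^-1` [set i] `&` xi @^-1` [set i]).
    apply/seteqP; split => x /=.
      by move/eqP => zx [i _ [/= z1 z2]]; apply: zx; rewrite z1 z2.
    by move=> h; apply/eqP => zx; apply: h; exists (xi x).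
  apply: measurableC; apply: fin_bigcup_measurable => // i _.
  by apply: measurableI; [exact: mz|exact: mxi].
exists M, zeta; split => //.
pose S (i : nat) : set X :=
  if insub i is Some j then symdiff (xi @^-1` [set j]) (MB j).2 else set0.
have mSn i : measurable (S i) by rewrite /S; case: insub.
have SE (i : 'I_k) : S i = symdiff (xi @^-1` [set i]) (MB i).2.
  by rewrite /S valK.
apply: le_trans (_ : prob mu (\big[setU/set0]_(i < k) S i) <= _).
  apply: prob_le => //; first exact: bigsetU_measurable.
  move=> x /= zx; rewrite -bigcup_mkord; apply: contrapT => no.
  have nS (i : 'I_k) : ~ symdiff (xi @^-1` [set i]) (MB i).2 x.
    by move=> Six; apply: no; exists i => //=; rewrite SE.
  have Bx i : (MB i).2 x <-> xi x = i.
    have := nS i; rewrite /symdiff /= => h.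
    have [?|?] := pselect ((MB i).2 x); have [?|?] := pselect (xi x = i); tauto.
  case/negP: zx; rewrite /zeta; case: pickP => [i /asboolP/Bx -> //|/(_ (xi x))/asboolP].
  by case; apply/Bx.
apply: le_trans (prob_bigU _ _ mSn) _.
apply: le_trans (_ : \sum_(i < k) (e / k.+1%:R) <= _).
  by apply: ler_sum => i _; rewrite SE; exact: ltW (proj2 (hMB i)).
rewrite sumr_const card_ord -[_ *+ k]mulr_natl mulrCA.
by rewrite ler_piMr ?ler_pdivrMr// ?mul1r ?ler_nat//; exact: ltW.
Qed.

End approximation.

(** * The mean of the rate dominates entropy *)

Section entropy_bound.
Context {R : realType}.
Local Notation X := borel_full_shift.
Variable mu : probability X R.
Hypothesis inv : shift_invariant mu.

Definition point_of_word (w : seq bool) : full_shift :=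
  fun p : int => if p is Posz q then nth false w q else false.

Lemma agree_point_of_word (x : full_shift) (M j L : nat) : (j + M + M < L)%N ->
  agree M (iter (j + M) shift_map (point_of_word (word x L)))
    (iter (j + M) shift_map x).
Proof.
move=> jL p hp; rewrite !iter_shiftE.
have [q [-> qL]] : exists q : nat, p + (j + M)%N%:Z = q%:Z /\ (q < L)%N.
  by exists (absz (p + (j + M)%N%:Z)); lia.
by rewrite /= nth_mkseq.
Qed.

Lemma join_entropy_shift (k : nat) (xi : X -> 'I_k) (M n : nat) :
  measurable_labelling xi ->
  join_entropy mu (fun x => xi (iter M shift_map x)) n = join_entropy mu xi n.
Proof.
move=> mxi; rewrite /join_entropy; apply: eq_bigr => w _.
suff -> : mu (join_cell (fun x : X => xi (iter M shift_map x)) w) =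
  mu (join_cell xi w) by [].
rewrite -[RHS](invariant_iter inv M); last exact: join_cell_measurable.
congr (mu _); apply/seteqP; split => x /= h j.
  by rewrite -h -!iterD addnC.
by rewrite -iterD addnC iterD h.
Qed.

Lemma measurable_labelling_iter (k : nat) (xi : X -> 'I_k) (M : nat) :
  measurable_labelling xi -> measurable_labelling (fun x : X => xi (iter M shift_map x)).
Proof.
move=> mxi i; rewrite -[X in measurable X]setTI.
exact: (iter_shift_measurable M measurableT (mxi i)).
Qed.

(** A transition kernel that keeps a label with probability 1 - dl: it corrects the
labels of an approximating labelling. *)
Definition kappa (k : nat) (dl : R) (a b : 'I_k) : R :=
  if a == b then 1 - dl else dl / k%:R.

Lemma sum_kappa (k : nat) (dl : R) (a : 'I_k) : 0 <= dl ->
  \sum_b kappa dl a b <= 1.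
Proof.
move=> d0; have k0 : (0 < k)%N by case: (k) a => [[]|].
have k0R : 0 < k%:R :> R by rewrite ltr0n.
rewrite (bigD1 a)//= /kappa eqxx.
apply: le_trans (_ : 1 - dl + \sum_(b < k) dl / k%:R <= _).
  rewrite lerD2l [leRHS](bigD1 a)//=.
  apply: le_trans (_ : \sum_(b < k | b != a) dl / k%:R <= _); last first.
    by rewrite lerDr divr_ge0.
  by apply: ler_sum => b ba; rewrite eq_sym (negbTE ba).
by rewrite sumr_const card_ord -[_ *+ k]mulr_natl mulrC divfK ?gt_eqF// subrK.
Qed.

Lemma kappa_gt0 (k : nat) (dl : R) (a b : 'I_k) : 0 < dl < 1 -> 0 < kappa dl a b.
Proof.
move=> /andP[d0 d1]; rewrite /kappa; case: eqP => _; first by rewrite subr_gt0.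
by rewrite divr_gt0// ltr0n; case: (k) a => [[]|].
Qed.

Lemma le_sum_mem (I : eqType) (s : seq I) (F : I -> R) (i : I) : i \in s ->
  (forall j, j \in s -> 0 <= F j) -> F i <= \sum_(j <- s) F j.
Proof.
move=> si F0; rewrite (big_rem i)//= lerDl big_seq; apply: sumr_ge0 => j /mem_rem.
exact: F0.
Qed.

(** The itinerary of x under xi is encoded by a code for a window of x, which
determines the itinerary under the window labelling zeta, and by the corrections
from zeta to xi.  A correct label costs - log2 (1 - dl), at most e / 4; errors
are so rare that their mean cost is at most e / 4. *)
Lemma join_entropy_le (k : nat) (xi : X -> 'I_k) (e : R) :
  measurable_labelling xi -> 0 < e ->
  exists C : R, forall n : nat,
    join_entropy mu xi n <= n%:R * (mean mu rate + e) + C.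
Proof.
move=> mxi e0.
have ln20 := @ln2_pos R.
have k0 : (0 < k)%N by case: (k) (xi point) => [[]|].
have k0R : 0 < k%:R :> R by rewrite ltr0n.
have [dl [d01 hd]] : exists dl : R, 0 < dl < 1 /\ - log2 (1 - dl) <= e / 4.
  exists (1 - expR (- (ln 2 * (e / 4)))); split.
    rewrite subr_gt0 expR_lt1 oppr_lt0 mulr_gt0 ?divr_gt0//=.
    by rewrite gtrBl expR_gt0.
  by rewrite subKr -/(pow2N _) log2_pow2N opprK.
have /andP[d0 d1] := d01.
pose Q : R := Num.max 0 (- log2 (dl / k%:R)).
have Q0 : 0 <= Q by rewrite le_max lexx.
have q1 : 0 < e / 4 / (Q + 1) by rewrite !divr_gt0//; lra.
have [M [zeta [wz mbad hz]]] := window_labelling mu mxi q1.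
set bad : set X := [set x | zeta x != xi x] in mbad hz.
pose D (x : X) : R := - log2 (1 - dl) + (- log2 (dl / k%:R) + log2 (1 - dl)) * \1_bad x.
have DE x : pow2N (D x) = kappa dl (zeta x) (xi x).
  have kp := kappa_gt0 (zeta x) (xi x) d01.
  rewrite -[RHS]pow2N_log2//; congr pow2N; rewrite /D indicE /kappa.
  case: ifPn => zx; first by rewrite memNset ?mulr0 ?addr0// /bad /= zx.
  by rewrite mem_set//= mulr1; lra.
have bD : bounded_measurable D.
  by apply: bmD; [exact: bm_cst|apply: bmZ; exact: bm_indic].
have mD : mean mu D <= e / 2.
  rewrite meanD; [|exact: bm_cst|by apply: bmZ; exact: bm_indic].
  rewrite mean_cst meanZ; last exact: bm_indic.
  rewrite mean_indic//.
  have p0 := prob_ge0 mu bad.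
  have lg : log2 (1 - dl) <= 0.
    by rewrite -log21; apply: log2_le; lra.
  have h1 : (- log2 (dl / k%:R) + log2 (1 - dl)) * prob mu bad <= Q * prob mu bad.
    apply: ler_wpM2r => //; have : - log2 (dl / k%:R) <= Q by rewrite le_max lexx orbT.
    lra.
  have h2 : Q * prob mu bad <= e / 4.
    apply: le_trans (_ : Q * (e / 4 / (Q + 1)) <= _); first exact: ler_wpM2l.
    by rewrite mulrA ler_pdivrMr; nra.
  lra.
have [C [C0 hC]] := @log2_window_mass R (e / 2) ltac:(lra).
have r0 := mean_rate_ge0 mu.
exists ((M + M).+1%:R * (mean mu rate + e / 2) + C) => n.
(* after a shift by M, the windows of zeta along n steps lie within the
   coordinates from 0 to L - 1 *)
rewrite -(join_entropy_shift M n mxi).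
pose L := (n + (M + M).+1)%N.
pose rho (v : {ffun 'I_n -> 'I_k}) : R :=
  \sum_(c <- window_codes L) c.2 *
    \prod_(j < n) kappa dl (zeta (iter (j + M) shift_map (point_of_word c.1))) (v j).
have kp0 a b : 0 <= kappa (k := k) dl a b by exact: ltW (kappa_gt0 _ _ d01).
pose G (x : X) : R := birkhoff rate L x + birkhoff D n (iter M shift_map x).
have bG : bounded_measurable G.
  apply: bmD; first exact: bm_birkhoff bm_rate.
  exact: (bm_iter M (bm_birkhoff n bD)).
have mG : mean mu G = L%:R * mean mu rate + n%:R * mean mu D.
  rewrite meanD; [|exact: bm_birkhoff bm_rate|exact: (bm_iter M (bm_birkhoff n bD))].
  rewrite (mean_birkhoff inv _ bm_rate) (mean_iter inv M (bm_birkhoff n bD)).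
  by rewrite (mean_birkhoff inv _ bD).
have Z0 : 0 < 4 * (L%:R + 1) ^+ 4 :> R by rewrite mulr_gt0// exprn_gt0// ltr_wpDl.
have := @gibbs_inequality R mu k _ (measurable_labelling_iter M mxi) n rho G
  (4 * (L%:R + 1) ^+ 4) _ _ Z0 bG _.
move=> H; apply: le_trans (H _ _ _) _ => {H}.
- move=> v; rewrite /rho big_seq; apply: sumr_ge0 => c hc.
  by rewrite mulr_ge0 ?(window_codes_ge0 hc)// prodr_ge0.
- rewrite /rho exchange_big /=; apply: le_trans (window_codes_mass L).
  rewrite /mass big_seq [leRHS]big_seq; apply: ler_sum => c hc.
  rewrite -mulr_sumr ler_piMr ?(window_codes_ge0 hc)//.
  rewrite -(bigA_distr_bigA (fun (j : 'I_n) b =>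
    kappa dl (zeta (iter (j + M) shift_map (point_of_word c.1))) b)).
  apply: prodr_ile1 => j _; rewrite sumr_ge0//=.
  by apply: sum_kappa; exact: ltW.
- move=> x; have [c [cin cw cp]] := window_codes_word (R := R) L x.
  apply: le_trans (le_sum_mem (F := fun c => c.2 * _) cin _); last first.
    by move=> c' hc' /=; rewrite mulr_ge0 ?(window_codes_ge0 hc')// prodr_ge0.
  rewrite /G pow2ND; apply: ler_pM; rewrite ?(ltW (pow2N_gt0 _))//.
  rewrite (big_morph pow2N pow2ND pow2N0) le_eqVlt; apply/orP; left; apply/eqP.
  apply: eq_bigr => j _; rewrite DE ffunE cw -!iterD (addnC M j).
  have jL : (j + M + M < L)%N.
    by rewrite /L -addnA addnS ltnS leq_add2r ltnW.
  by rewrite (wz _ _ (@agree_point_of_word x M j L jL)).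
- rewrite mG /L natrD; have := hC L; rewrite /L natrD.
  have n0 : 0 <= n%:R :> R by [].
  have : n%:R * mean mu D <= n%:R * (e / 2) by exact: ler_wpM2l.
  lra.
Qed.

(** Where the limit in the definition does not exist, limn takes the value 0, which
the nonnegative mean of the rate dominates too. *)
Lemma partition_entropy_le (k : nat) (xi : X -> 'I_k) :
  measurable_labelling xi -> partition_entropy mu xi <= mean mu rate.
Proof.
move=> mxi; rewrite /partition_entropy.
have r0 := mean_rate_ge0 mu.
set u := (fun n : nat => _).
have [/eqP ->|/cvgNpoint cu] := boolP (limn u == point); first exact: r0.
apply/ler_addgt0Pr => e e0.
have [C hC] := join_entropy_le mxi (ltac:(lra) : 0 < e / 2).
apply: limr_le => //.
exists (Num.truncn (`|C| / (e / 2))).+1 => // n /= Kn.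
have n0 : 0 < n%:R :> R by rewrite ltr0n; apply: leq_trans Kn.
rewrite /u ler_pdivrMr//; apply: le_trans (hC n) _.
have : C <= e / 2 * n%:R.
  apply: le_trans (ler_norm _) _; rewrite mulrC -ler_pdivrMr; last lra.
  by apply: ltW; apply: lt_le_trans (truncnS_gt _) _; rewrite ler_nat.
lra.
Qed.

Lemma entropy_le_mean_rate : (entropy mu <= (mean mu rate)%:E)%E.
Proof.
apply: ub_ereal_sup => _ [k [xi [mxi ->]]].
by rewrite lee_fin; exact: partition_entropy_le.
Qed.

Lemma entropy_gtNy : (-oo < entropy mu)%E.
Proof.
pose xi (x : X) : 'I_1 := ord0.
apply: (@lt_le_trans _ _ (partition_entropy mu xi)%:E); first exact: ltNyr.
apply: ereal_sup_ubound; exists 1%N, xi; split => // i.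
rewrite (_ : xi @^-1` [set i] = setT); first exact: measurableT.
by apply/seteqP; split => x //= _; rewrite /xi /= (ord1 i).
Qed.

End entropy_bound.

(** * Coin tossing *)

Section digits.
Context {R : realType}.

Definition digit (j : nat) (u : R) : bool := odd (Num.truncn (2 ^+ j.+1 * u)).

Fixpoint dyadic_index (w : nat -> bool) (n : nat) : nat :=
  if n is m.+1 then (2 * dyadic_index w m + w m)%N else 0%N.

Lemma digit_cylinder (w : nat -> bool) (n : nat) :
  `[0, 1[ `&` [set u : R | forall j, (j < n)%N -> digit j u = w j] =
  `[(dyadic_index w n)%:R / 2 ^+ n, (dyadic_index w n).+1%:R / 2 ^+ n[%classic.
Proof.
elim: n => [|n IH].
  rewrite /= !expr0 !divr1; apply/seteqP; split => u /=; first by case.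
  by move=> h; split.
have -> : `[0, 1[ `&` [set u : R | forall j, (j < n.+1)%N -> digit j u = w j] =
    (`[0, 1[ `&` [set u : R | forall j, (j < n)%N -> digit j u = w j]) `&`
    [set u | digit n u = w n].
  apply/seteqP; split => u /=.
    by move=> [u01 h]; split; [split=> // j jn; apply: h; exact: ltnW|exact: h].
  move=> [[u01 h] hn]; split => // j; rewrite ltnS leq_eqVlt => /orP[/eqP -> //|].
  exact: h.
rewrite IH; set k := dyadic_index w n.
have p0 : 0 < 2 ^+ n :> R by rewrite exprn_gt0.
have ps : 2 ^+ n.+1 = 2 * 2 ^+ n :> R by rewrite exprS.
have k0 : 0 <= k%:R :> R by [].
apply/seteqP; split => u /=; rewrite !in_itv /= -/k ps !ler_pdivrMr ?ltr_pdivlMr ?mulr_gt0//.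
  move=> [/andP[ku uk]]; rewrite /digit ps.
  set t := 2 * 2 ^+ n * u.
  have tE : t = 2 * (u * 2 ^+ n) by rewrite /t -mulrA [_ * u]mulrC.
  have t0 : 0 <= t by rewrite tE; lra.
  have := truncn_itv t0; set m := Num.truncn t => /andP[mt tm].
  rewrite -natr1 in uk; rewrite -natr1 in tm.
  have h1 : (2 * k < m.+1)%N.
    by rewrite -(ltr_nat R) natrM -natr1; lra.
  have h2 : (m < 2 * k + 2)%N.
    by rewrite -(ltr_nat R) natrD natrM; lra.
  move=> ow; have mE : m = (2 * k + w n)%N by rewrite -ow; lia.
  rewrite mulrC -/t -mE -natr1; apply/andP; split; lra.
move=> /andP[ku uk]; set t := 2 * 2 ^+ n * u.
have tE : t = 2 * (u * 2 ^+ n) by rewrite /t -mulrA [_ * u]mulrC.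
rewrite mulrC -/t in ku; rewrite mulrC -/t in uk.
have tr : Num.truncn t = (2 * k + w n)%N by apply: truncn_def; rewrite ku uk.
split; last by rewrite /digit ps -/t tr oddD oddM /=; case: (w n).
rewrite -natr1 natrD natrM in uk; rewrite natrD natrM in ku.
have w0 : 0 <= (w n)%:R :> R by [].
have w1 : (w n)%:R <= 1 :> R by case: (w n).
by rewrite -natr1; apply/andP; split; lra.
Qed.

Lemma digit_measurable (j : nat) : measurable [set u : R | digit j u].
Proof.
have -> : [set u : R | digit j u] = \bigcup_(k in [set k | odd k])
    `[k%:R / 2 ^+ j.+1, k.+1%:R / 2 ^+ j.+1[%classic.
  have p0 : 0 < 2 ^+ j.+1 :> R by rewrite exprn_gt0.
  apply/seteqP; split => u /=.
    rewrite /digit => o; exists (Num.truncn (2 ^+ j.+1 * u)) => //=.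
    have u0 : 0 <= 2 ^+ j.+1 * u.
      rewrite leNgt; apply/negP => h; move: o; rewrite truncn_floor.
      by rewrite leNgt h.
    rewrite in_itv /= ler_pdivrMr// ltr_pdivlMr// [u * _]mulrC.
    exact: truncn_itv.
  move=> [k /= ok]; rewrite in_itv /= ler_pdivrMr// ltr_pdivlMr// [u * _]mulrC => h.
  by rewrite /digit (truncn_def h).
by apply: bigcup_measurable => k _; exact: measurable_itv.
Qed.

End digits.

Section shift_measures.
Context {R : realType}.
Local Notation X := borel_full_shift.

Lemma window_set_cover (M : nat) (A : set full_shift) : window_set M A ->
  A = \bigcup_(w in [set w : {ffun 'I_(M + M).+1 -> bool} |
        exists2 x, A x & forall j : 'I_(M + M).+1, x (j%:Z - M%:Z) = w j])
      \bigcap_(j in [set: 'I_(M + M).+1]) [set x | x (j%:Z - M%:Z) = w j].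
Proof.
move=> wA; apply/seteqP; split => x.
  move=> Ax; exists [ffun j : 'I_(M + M).+1 => x (j%:Z - M%:Z)] => /=.
    by exists x => // j; rewrite ffunE.
  by move=> j _ /=; rewrite ffunE.
move=> [w /= [y Ay yw] xw]; apply: wA Ay => p pM.
have pj : (absz (p + M%:Z)%R < (M + M).+1)%N by lia.
have := yw (Ordinal pj); have := xw (Ordinal pj) Logic.I => /=.
by rewrite (_ : _ - _ = p); [move=> -> ->|lia].
Qed.

Lemma open_window_cover (A : set full_shift) : open A ->
  A = \bigcup_M [set x | agree M x `<=` A].
Proof.
move=> oA; apply/seteqP; split => x; last by move=> [M _]; apply.
by move=> Ax; have [M hM] := open_agree oA Ax; exists M.
Qed.

Lemma window_interior (A : set full_shift) (M : nat) :
  window_set M [set x | agree M x `<=` A].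
Proof. by move=> x y xy Fx z yz; apply: Fx => p hp; rewrite xy// yz. Qed.

Lemma measurable_to_shift d (T : measurableType d) (S : T -> X) :
  (forall p : int, measurable [set y | S y p]) -> measurable_fun setT S.
Proof.
move=> mS.
have mSb (p : int) (b : bool) : measurable [set y | S y p = b].
  case: b; first exact: mS.
  rewrite (_ : [set y | _] = ~` [set y | S y p]); first exact/measurableC/mS.
  by apply/seteqP; split => y /=; case: (S y p).
apply: (@measurability _ _ T X setT S (@open full_shift)) => //.
move=> _ [A oA <-]; rewrite setTI (open_window_cover oA) preimage_bigcup.
apply: bigcup_measurable => M _.
rewrite (window_set_cover (@window_interior A M)) preimage_bigcup.
apply: fin_bigcup_measurable; first exact: finite_finset.
move=> w _; rewrite preimage_bigcap; apply: fin_bigcap_measurable => // j _.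
exact: mSb.
Qed.

Definition cylinder (ps : seq int) (w : int -> bool) : set X :=
  [set x | forall p, p \in ps -> x p = w p].

Lemma cylinder_window (ps : seq int) (w : int -> bool) :
  window_set (\max_(p <- ps) `|p|%N) (cylinder ps w).
Proof.
move=> x y xy xw p pps; rewrite -xw//; apply/esym/xy.
exact: (leq_bigmax_seq (F := fun p : int => `|p|%N)).
Qed.

Lemma cylinder_measurable (ps : seq int) (w : int -> bool) : measurable (cylinder ps w).
Proof. exact: window_set_measurable (@cylinder_window ps w). Qed.

Lemma probability_push d (T : measurableType d) (P : probability T R) (S : T -> X) :
  measurable_fun setT S -> exists Q : probability X R, forall A, Q A = P (S @^-1` A).
Proof.
move=> mS.
pose m : {measure set X -> \bar R} :=
  measure_function_pushforward__canonical__measure_function_Measure P mS.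
pose PS := Measure_isProbability.Build _ _ _ m (probability_setT P).
pose Q : probability X R := HB.pack (Measure.sort m) PS.
by exists Q.
Qed.

End shift_measures.

Section bernoulli.
Context {R : realType}.
Local Notation X := borel_full_shift.

Lemma unit_interval_probability : exists P : probability (measurableTypeR R) R,
  forall A, measurable A -> P A = lebesgue_measure (`[0, 1[%classic `&` A).
Proof.
have mI : measurable (`[0, 1[%classic : set (measurableTypeR R)) by exact: measurable_itv.
pose m : {measure set (measurableTypeR R) -> \bar R} :=
  measure_function_mrestr__canonical__measure_function_Measure lebesgue_measure mI.
have m1 : m setT = 1%E.
  by rewrite /m /= /mrestr setTI lebesgue_measure_itv /= lte01 oppr0 adde0.
pose PS := Measure_isProbability.Build _ _ _ m m1.
pose Q : probability (measurableTypeR R) R := HB.pack (Measure.sort m) PS.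
by exists Q => A mA; rewrite setIC.
Qed.

(** The binary digits of a uniform point of the unit interval, indexed by the
integers through [pickle].  Prescribing the first N digits selects a dyadic
interval; a set of fewer digits is reached by descending induction on its size,
adding up over the two values of a missing digit. *)
Lemma bernoulli_exists : exists P : probability X R,
  forall (ps : seq int) (w : int -> bool), uniq ps ->
    P (cylinder ps w) = (2^-1 ^+ size ps)%:E.
Proof.
have [P hP] := unit_interval_probability.
pose S (u : measurableTypeR R) : X := fun p : int => digit (pickle p) u.
have mS : measurable_fun setT S.
  by apply: measurable_to_shift => p; exact: digit_measurable.
have [Q hQ] := probability_push P mS.
exists Q => ps w ups; rewrite hQ.
pose D (s : seq nat) (v : nat -> bool) : set (measurableTypeR R) :=
  [set u | forall j, j \in s -> digit j u = v j].
have mD s v : measurable (D s v).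
  elim: s => [|j s IH].
    by rewrite (_ : D [::] v = setT)//; apply/seteqP; split.
  rewrite (_ : D (j :: s) v = D s v `&` [set u | digit j u = v j]).
    apply: measurableI => //; case: (v j); first exact: digit_measurable.
    rewrite (_ : [set u | _] = ~` [set u | digit j u]).
      by apply: measurableC; exact: digit_measurable.
    by apply/seteqP; split => u /=; case: (digit j u).
  apply/seteqP; split => u /=.
    move=> h; split; last by apply: h; rewrite inE eqxx.
    by move=> i si; apply: h; rewrite inE si orbT.
  by move=> [h1 h2] i; rewrite inE => /orP[/eqP -> //|]; exact: h1.
have key N m s v : uniq s -> (forall j, j \in s -> (j < N)%N) -> (size s + m)%N = N ->
    P (D s v) = (2^-1 ^+ size s)%:E.
  elim: m s v => [|m IH] s v us sN; rewrite ?addn0 => szN.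
    have sE j : (j \in s) = (j < N)%N.
      have ss : {subset s <= iota 0 N} by move=> i /sN iN; rewrite mem_iota.
      have [|_ e] := uniq_min_size us ss; first by rewrite size_iota szN.
      by rewrite e mem_iota.
    rewrite hP//; have -> : D s v = [set u | forall j, (j < N)%N -> digit j u = v j].
      apply/seteqP; split => u /= h j; last by rewrite sE; exact: h.
      by move=> jN; apply: h; rewrite sE.
    rewrite digit_cylinder lebesgue_measure_itv /= szN.
    have p0 : 0 < 2 ^+ N :> R by rewrite exprn_gt0.
    rewrite lte_fin ltr_pM2r ?invr_gt0// ltr_nat ltnSn -EFinB -mulrBl -natr1.
    by rewrite [_ + 1]addrC addrK mul1r exprVn.
  have [j jN js] : exists2 j, (j < N)%N & j \notin s.
    apply: contrapT => no; have : (size (iota 0 N) <= size s)%N.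
      apply: uniq_leq_size; first exact: iota_uniq.
      move=> j; rewrite mem_iota /= add0n => jN; apply: contrapT => js; apply: no.
      by exists j => //; apply/negP.
    by rewrite size_iota -szN; lia.
  pose vb b i := if i == j then b else v i.
  have split_D : D s v = D (j :: s) (vb true) `|` D (j :: s) (vb false).
    have vbs b i : i \in s -> vb b i = v i.
      by rewrite /vb => si; case: eqP => // ij; rewrite ij in si; rewrite si in js.
    have vbj b : vb b j = b by rewrite /vb eqxx.
    apply/seteqP; split => u /=.
      move=> h; case E : (digit j u); [left|right] => i;
        rewrite inE => /orP[/eqP ->|si]; rewrite ?vbj// vbs// h//.
    by move=> [h|h] i si; rewrite h ?vbs// inE si orbT.
  have IHb b : P (D (j :: s) (vb b)) = (2^-1 ^+ (size s).+1)%:E.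
    apply: (IH (j :: s) (vb b)); first by rewrite /= js.
      by move=> i; rewrite inE => /orP[/eqP ->|/sN].
    by rewrite -szN /= addSnnS.
  rewrite split_D measureU//; last first.
    apply/seteqP; split => u //= [h1 h2].
    have := h1 j; have := h2 j; rewrite /vb inE eqxx /= => -> //.
    by move=> /(_ isT).
  have -> : (P (D (j :: s) (vb true)) + P (D (j :: s) (vb false)))%E =
      ((2^-1 ^+ (size s).+1)%:E + (2^-1 ^+ (size s).+1)%:E)%E :> \bar R.
    by congr (_ + _)%E; exact: IHb.
  by rewrite -EFinD exprS -mulrDl [X in X * _](_ : _ = 1) ?mul1r//; field.
pose v j := if unpickle j is Some p then w p else false.
have <- : D [seq pickle p | p <- ps] v = S @^-1` cylinder ps w.
  apply/seteqP; split => u /= h.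
    by move=> p pps; rewrite /S (h _ (map_f _ pps)) /v pickleK.
  by move=> j /mapP[p pps ->]; rewrite /v pickleK -h.
rewrite -(size_map pickle ps).
set s := map _ _.
pose N := (\max_(j <- s) j.+1)%N.
have sN j : j \in s -> (j < N)%N.
  by move=> js; exact: (leq_bigmax_seq (F := fun j => j.+1)).
apply: (key N (N - size s)%N) => //.
  by rewrite map_inj_uniq//; exact: pcan_inj pickleK.
rewrite subnKC//; rewrite -(size_iota 0 N).
apply: uniq_leq_size; first by rewrite map_inj_uniq//; exact: pcan_inj pickleK.
by move=> j /sN; rewrite mem_iota.
Qed.

(** The window sets form a pi-system that generates the Borel sets, and each is a
finite disjoint union of cylinders. *)
Lemma eq_on_cylinders (P Q : probability X R) :
  (forall ps w, uniq ps -> P (cylinder ps w) = Q (cylinder ps w)) ->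
  forall A, measurable A -> P A = Q A.
Proof.
move=> PQ A mA.
pose G : set (set X) := [set A | exists M, window_set M A].
have Gm : G `<=` measurable by move=> B [M wB]; exact: window_set_measurable wB.
have GG A' : G A' -> P A' = Q A'.
  move=> [M wA]; have mA' := window_set_measurable wA.
  pose ps := [seq j%:Z - M%:Z | j <- iota 0 (M + M).+1].
  have ups : uniq ps by rewrite map_inj_uniq ?iota_uniq// => i j; lia.
  pose W := {ffun 'I_(M + M).+1 -> bool}.
  pose ext (w : W) (p : int) : bool :=
    if insub (absz (p + M%:Z)%R) is Some j then w j else false.
  have extE (w : W) (j : 'I_(M + M).+1) : ext w (j%:Z - M%:Z) = w j.
    by rewrite /ext subrK absz_nat valK.
  have cE (w : W) (x : X) : cylinder ps (ext w) x <->
      forall j : 'I_(M + M).+1, x (j%:Z - M%:Z) = w j.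
    split => h.
      move=> j; rewrite -extE; apply: h; apply/mapP; exists (val j) => //.
      by rewrite mem_iota; exact: (ltn_ord j).
    move=> p /mapP[j]; rewrite mem_iota => /= jM ->.
    by have := h (Ordinal jM) => /= ->; rewrite -(extE w (Ordinal jM)).
  pose T := [set w : W |
    exists2 x, A' x & forall j : 'I_(M + M).+1, x (j%:Z - M%:Z) = w j].
  have AE : A' = \bigcup_(w in T) cylinder ps (ext w).
    rewrite [LHS](window_set_cover wA); apply: eq_bigcupr => w _.
    apply/seteqP; split => x /=.
      by move=> h; apply/cE => j; exact: h.
    by move=> /cE h j _; exact: h.
  have tT : trivIset T (fun w => cylinder ps (ext w)).
    move=> w w' _ _ [x [/cE h /cE h']]; apply/ffunP => j.
    by rewrite -h -h'.
  rewrite AE !(@measure_fin_bigcup _ _ _ _ W) //; try exact: finite_finset.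
  - by apply: eq_fsbigr => w _; exact: PQ.
  - by move=> w _; exact: cylinder_measurable.
  - by move=> w _; exact: cylinder_measurable.
have setIG : setI_closed G.
  move=> B C [M wB] [M' wC]; exists (maxn M M') => x y xy [Bx Cx]; split.
    by apply: wB Bx; apply: agree_le xy; exact: leq_maxl.
  by apply: wC Cx; apply: agree_le xy; exact: leq_maxr.
apply: (@g_sigma_algebra_measure_unique _ R X G Gm (fun=> setT)) => //.
- by move=> _; exists 0%N.
- by apply/seteqP; split => // x _; exists 0%N.
- by move=> k; rewrite ltey_eq fin_num_measure.
move: A mA; apply: smallest_sub; first exact: smallest_sigma_algebra.
move=> A oA; rewrite (open_window_cover oA).
apply: (@bigcup_measurable _ (g_sigma_algebraType G)) => M _.
by apply: sub_sigma_algebra; exists M; exact: window_interior.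
Qed.

End bernoulli.

(** * Measures carried by tokens of one length *)

Section substitution.
Context {R : realType}.
Local Notation X := borel_full_shift.
Variable l : nat.
Hypothesis l3 : (3 <= l)%N.

(** The block from q l to (q + 1) l - 1 becomes 1 y_q 0 ... 0. *)
Definition substitute (y : X) : X := fun p : int =>
  ((p %% l%:Z)%Z == 0) || (((p %% l%:Z)%Z == 1) && y (p %/ l%:Z)%Z).

Lemma substituteE (y : X) (q : int) (r : nat) : (r < l)%N ->
  substitute y (q * l%:Z + r%:Z) = (r == 0%N) || ((r == 1%N) && y q).
Proof.
move=> rl; rewrite /substitute modzMDl divzMDl; last by lia.
rewrite modz_small; last by lia.
by rewrite divz_small ?addr0//; lia.
Qed.

Lemma int_decomp (p : int) : exists (q : int) (r : nat), (r < l)%N /\ p = q * l%:Z + r%:Z.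
Proof.
exists (p %/ l%:Z)%Z, (absz (p %% l%:Z)%Z).
have m0 : (0 <= p %% l%:Z)%Z by apply: modz_ge0; lia.
have ml : (p %% l%:Z < l%:Z)%Z by apply: ltz_pmod; lia.
by split; [lia|rewrite gez0_abs// -divz_eq].
Qed.

Lemma is_start_substitute (y : X) (p : int) :
  is_start (substitute y) p = (l %| p)%Z.
Proof.
have [q [r [rl ->]]] := int_decomp p.
rewrite /is_start substituteE// rpredDl ?dvdz_mull//.
have -> : (r%:Z \in dvdz l) = (r == 0%N).
  by rewrite -[LHS]/(l %| r%:Z)%Z dvdzE /=; case: r rl => [|r] rl; rewrite ?dvdn0// gtnNdvd.
case: r rl => [|[|r]] rl //=.
  rewrite (_ : q * l%:Z + 0 - 1 = (q - 1) * l%:Z + l.-1%:Z); last by lia.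
  by rewrite substituteE; [case: (l) l3 => [|[|[|k]]]|lia].
rewrite (_ : q * l%:Z + 1 - 1 = q * l%:Z + 0%N%:Z); last by lia.
rewrite (_ : q * l%:Z + 1 + 1 = q * l%:Z + 2%N%:Z); last by lia.
by rewrite !substituteE//= ?andbF//; lia.
Qed.

Lemma iter_substitute (y : X) : iter l shift_map (substitute y) = substitute (shift_map y).
Proof.
apply/funext => p; rewrite iter_shiftE.
have [q [r [rl ->]]] := int_decomp p.
rewrite (_ : q * l%:Z + r%:Z + l%:Z = (q + 1) * l%:Z + r%:Z); last first.
  by rewrite mulrDl mul1r addrAC.
by rewrite !substituteE.
Qed.

Lemma substitute_measurable : measurable_fun setT substitute.
Proof.
apply: measurable_to_shift => p.
apply: (@window_set_measurable (absz (p %/ l%:Z)%Z)) => x y xy /=.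
by rewrite /substitute xy.
Qed.

(** All tokens have length l, so that the cost is taken along an infinite run. *)
Lemma rate_regular (x : X) (c : nat) :
  (forall p, is_start x p = (l %| p + c%:Z)%Z) -> rate x = l%:R^-1 :> R.
Proof.
move=> h; have cl : (c %% l < l)%N by rewrite ltn_mod; lia.
have ab : (c %% l + (l - c %% l))%N = l by rewrite subnKC// ltnW.
have b0 : (0 < l - c %% l)%N by rewrite subn_gt0.
have r i : run x (c %% l) (l - c %% l) i.
  move=> p _; rewrite h ab.
  have -> : (l - c %% l)%N%:Z - p%:Z + c%:Z = ((c %/ l).+1 * l)%N%:Z - p%:Z.
    by have := divn_eq c l; rewrite mulSn; lia.
  rewrite rpredBl; first by rewrite -[LHS]/(l %| p%:Z)%Z dvdzE.
  by rewrite PoszM dvdz_mull.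
apply/le_anti/andP; split; last first.
  apply: (rate_ge b0 (r 0%N)) => i _; rewrite ab.
  by apply: unit_cost_ge; lia.
apply/ler_addgt0Pr => e e0; have [K hK] := unit_cost_stable e0.
by apply: le_trans (rate_le b0 (r K)) _; rewrite ab; apply: hK; lia.
Qed.

Lemma rate_substitute (y : X) (j : nat) :
  rate (iter j shift_map (substitute y)) = l%:R^-1 :> R.
Proof.
apply: (@rate_regular _ j) => p.
by rewrite is_start_iter is_start_substitute.
Qed.

Lemma probability_average (P : nat -> probability X R) (n : nat) :
  exists Q : probability X R, forall A, measurable A ->
    prob Q A = n.+1%:R^-1 * \sum_(j < n.+1) prob (P j) A.
Proof.
have n0 : 0 <= n.+1%:R^-1 :> R by rewrite invr_ge0.
pose m : {measure set X -> \bar R} := mscale (NngNum n0) (msum P n.+1).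
have mE A : measurable A -> m A = (n.+1%:R^-1 * \sum_(j < n.+1) prob (P j) A)%:E.
  move=> mA; rewrite /m /= /mscale /= /msum EFinM; congr (_ * _)%E.
  by rewrite -sumEFin; apply: eq_bigr => j _; rewrite -probE.
have m1 : m setT = 1%E.
  rewrite mE// (eq_bigr (fun=> 1)).
    by rewrite sumr_const card_ord mulVf// pnatr_eq0.
  by move=> j _; exact: (congr1 fine (probability_setT (P j))).
pose PS := Measure_isProbability.Build _ _ _ m m1.
pose Q : probability X R := HB.pack (Measure.sort m) PS.
exists Q => A mA; exact: (congr1 fine (mE A mA)).
Qed.

Lemma mean_ae_const (mu : probability X R) (h : X -> R) (c : R) (E : set X) :
  measurable E -> prob mu (~` E) = 0 -> (forall x, E x -> h x = c) ->
  bounded_measurable h -> mean mu h = c.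
Proof.
move=> mE E0 hc bh; have [_ [C hC]] := bh.
have mEc := measurableC mE.
have bE (s : R) : bounded_measurable (fun x : X => c + s * \1_(~` E) x).
  by apply: bmD; [exact: bm_cst|apply: bmZ; exact: bm_indic].
have mEs (s : R) : mean mu (fun x : X => c + s * \1_(~` E) x) = c.
  rewrite meanD; [|exact: bm_cst|by apply: bmZ; exact: bm_indic].
  by rewrite mean_cst meanZ ?mean_indic// ?E0 ?mulr0 ?addr0//; exact: bm_indic.
have bound x : `|h x - c| <= (C + `|c|) * \1_(~` E) x.
  rewrite indicE; have [Ex|nEx] := pselect (E x).
    by rewrite hc// subrr normr0 memNset ?mulr0// => /(_ Ex).
  by rewrite mem_set// mulr1 (le_trans (ler_normB _ _))// lerD2r.
apply/le_anti/andP; split.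
  rewrite -[leRHS](mEs (C + `|c|)); apply: mean_le => // x.
  by have := bound x; rewrite ler_norml => /andP[_]; lra.
rewrite -[leLHS](mEs (- (C + `|c|))); apply: mean_le => // x.
by have := bound x; rewrite ler_norml => /andP[+ _]; lra.
Qed.

Definition coordinate_label (x : X) : 'I_2 := inord (x 0).

Lemma coordinate_labelE (x : X) : val (coordinate_label x) = x 0 :> nat.
Proof. by rewrite /= inordK//; case: (x 0). Qed.

Lemma coordinate_label_measurable : measurable_labelling coordinate_label.
Proof.
move=> i; apply: (@window_set_measurable 0%N) => x y xy /= <-.
by rewrite /coordinate_label xy.
Qed.

(** The image of coin tossing under [substitute], averaged over the l shifts.  A cell
of n coordinates contains about n / l free symbols, so its probability is at most
2^-m with m close to n / l, which bounds entropy from below.  The upper bound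
[join_entropy_le] makes the defining limit exist. *)
Lemma substitute_measure : exists mu : probability X R,
  [/\ shift_invariant mu,
      (forall (h : X -> R) (c : R), bounded_measurable h ->
         (forall x : X, rate x = l%:R^-1 :> R -> h x = c) -> mean mu h = c) &
      (l%:R^-1%:E <= entropy mu)%E].
Proof.
have [P hP] := @bernoulli_exists R.
have invP (A : set X) : measurable A -> P (shift_map @^-1` A) = P A.
  have [Q hQ] := probability_push P (iter_shift_measurable 1).
  move=> mA; rewrite -[LHS]hQ; apply: eq_on_cylinders => // ps w ups.
  rewrite hQ hP//.
  have -> : iter 1 shift_map @^-1` cylinder ps w =
      cylinder [seq p + 1 | p <- ps] (fun p => w (p - 1)).
    apply/seteqP; split => x /= h p.
      by move=> /mapP[q qps ->]; rewrite -addrA subrr addr0 -(h q qps).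
    by move=> pps; rewrite /shift_map h ?addrK//; exact: map_f.
  by rewrite hP ?size_map// map_inj_uniq// => p q; lia.
pose S j (y : X) : X := iter j shift_map (substitute y).
have mS j : measurable_fun setT (S j).
  exact: measurableT_comp (iter_shift_measurable j) substitute_measurable.
have /choice[Q hQ] : forall j, exists Q : probability X R, forall A, Q A = P (S j @^-1` A).
  by move=> j; exact: probability_push.
have mSA j (A : set X) : measurable A -> measurable (S j @^-1` A).
  by move=> mA; rewrite -[X in measurable X]setTI; exact: mS.
have lE : l.-1.+1 = l by lia.
have l0 : 0 < l%:R :> R by rewrite ltr0n; lia.
have [mu hmu] := probability_average Q l.-1; rewrite lE in hmu.
have inv : shift_invariant mu.
  move=> A mA.
  have mTA : measurable (shift_map @^-1` A : set X).
    by rewrite -[X in measurable X]setTI; exact: (iter_shift_measurable 1).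
  rewrite !probE// !hmu//; congr (_ * _)%:E.
  rewrite (eq_bigr (fun j : 'I_l => prob (Q j.+1) A)); last first.
    by move=> j _; rewrite /prob !hQ.
  rewrite -lE big_ord_recr [RHS]big_ord_recl /= addrC; congr (_ + _).
  rewrite /prob !hQ lE; congr fine; rewrite -[RHS]invP; last exact: (mSA 0%N).
  congr (P _); apply/seteqP; split => x /=; by rewrite /S iter_substitute.
have mrate : measurable [set x : X | rate x = l%:R^-1 :> R].
  rewrite -[X in measurable X]setTI.
  have [mr0 _] := @bm_rate R.
  exact: (mr0 measurableT _ (measurable_set1 (l%:R^-1 : R))).
have hmean (h : X -> R) (c : R) : bounded_measurable h ->
    (forall x : X, rate x = l%:R^-1 :> R -> h x = c) -> mean mu h = c.
  move=> bh hc; apply: (mean_ae_const mrate) => //.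
  rewrite hmu; last exact: measurableC.
  rewrite big1 ?mulr0// => j _; rewrite /prob hQ.
  rewrite (_ : S j @^-1` _ = set0) ?measure0//.
  by apply/seteqP; split => y //=; apply; exact: rate_substitute.
exists mu; split => //.
apply: (@le_trans _ _ (partition_entropy mu coordinate_label)%:E); last first.
  apply: ereal_sup_ubound; exists 2%N, coordinate_label; split => //.
  exact: coordinate_label_measurable.
rewrite lee_fin.
have mr : mean mu rate = l%:R^-1 by apply: hmean => //; exact: bm_rate.
(* in each of the l phases the free symbols of the blocks 1 to m fall into
   the window *)
have cell n m (v : {ffun 'I_n -> 'I_2}) : (m * l + 2 <= n)%N ->
    prob mu (join_cell coordinate_label v) <= 2^-1 ^+ m.
  move=> mn; have mc := join_cell_measurable coordinate_label_measurable v.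
  rewrite hmu// mulrC ler_pdivrMr//.
  apply: le_trans (_ : \sum_(j < l) 2^-1 ^+ m <= _); last first.
    by rewrite sumr_const card_ord mulr_natr.
  apply: ler_sum => j _.
  pose w (q : int) : bool :=
    if insub (absz (q * l%:Z + 1 - j%:Z)%R) is Some i then val (v i) == 1%N else false.
  pose ps := [seq k.+1%:Z | k <- iota 0 m].
  have ups : uniq ps by rewrite map_inj_uniq ?iota_uniq// => p q; lia.
  have -> : prob (Q j) (join_cell coordinate_label v) =
      prob P (S j @^-1` join_cell coordinate_label v) by rewrite /prob hQ.
  have -> : 2^-1 ^+ m = prob P (cylinder ps w).
    by rewrite /prob hP// size_map size_iota.
  apply: prob_le; [exact: mSA|exact: cylinder_measurable|].
  move=> y /= hy p /mapP[k]; rewrite mem_iota => /= km ->.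
  have jl := ltn_ord j.
  have [i iE] : exists i : 'I_n, (i + j)%N = (k.+1 * l + 1)%N.
    have ln : (k.+1 * l + 1 - j < n)%N by nia.
    by exists (Ordinal ln) => /=; nia.
  have aE : absz (k.+1%:Z * l%:Z + 1 - j%:Z)%R = i.
    have : k.+1%:Z * l%:Z + 1 = (i + j)%N%:Z by rewrite iE PoszD PoszM.
    by lia.
  rewrite /w aE valK -(hy i) coordinate_labelE.
  rewrite /S -iterD iter_shiftE add0r iE PoszD PoszM.
  by rewrite (@substituteE y k.+1%:Z 1) ?eqb1 //=; lia.
have lower n : n%:R / l%:R - 2 <= join_entropy mu coordinate_label n.
  pose m := ((n - 2) %/ l)%N.
  have hm : n%:R / l%:R - 2 <= m%:R :> R.
    rewrite lerBlDr ler_pdivrMr//.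
    have : (n <= (m + 2) * l)%N.
      have := divn_eq (n - 2) l; have : ((n - 2) %% l < l)%N by rewrite ltn_mod; lia.
      by rewrite -/m; nia.
    by rewrite -(ler_nat R) natrM natrD.
  apply: le_trans hm _.
  have je0 (v : {ffun 'I_n -> 'I_2}) : prob mu (join_cell coordinate_label v) * m%:R <=
      - (prob mu (join_cell coordinate_label v) *
         log2 (prob mu (join_cell coordinate_label v))).
    set p := prob mu _.
    have p0 : 0 <= p := prob_ge0 _ _.
    have pm : p <= 2^-1 ^+ m.
      have [m0|m0] := posnP m; last first.
        by apply: cell; have := leq_divM (n - 2) l; rewrite -/m => h; nia.
      rewrite m0 expr0 -[leRHS](_ : prob mu setT = 1); last first.
        exact: (congr1 fine (probability_setT mu)).
      by apply: prob_le => //; exact: (join_cell_measurable coordinate_label_measurable).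
    have [->|pn0] := eqVneq p 0; first by rewrite !mul0r oppr0.
    rewrite -mulrN ler_wpM2l//.
    have pp : 0 < p by rewrite lt_def pn0.
    rewrite lerNr; apply: le_trans (log2_le pp pm) _.
    rewrite /log2 lnXn ?invr_gt0// lnV ?posrE// mulNrn mulNr -[ln 2 *+ m]mulr_natl.
    by rewrite mulfK// gt_eqF// ln2_pos.
  rewrite -[leLHS]mul1r.
  rewrite -[X in X * _](sum_join_cell mu coordinate_label_measurable n) mulr_suml.
  by apply: ler_sum => v _; exact: je0.
rewrite le_eqVlt; apply/orP; left; apply/eqP/esym.
apply: cvg_lim => //; apply/cvgrPdist_le => e e0.
have [C hC] := join_entropy_le inv coordinate_label_measurable (ltac:(lra) : 0 < e / 2).
exists (Num.truncn ((`|C| + 2) / (e / 2))).+1 => // n /= Kn.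
have n0 : 0 < n%:R :> R by rewrite ltr0n; apply: leq_trans Kn.
have big : `|C| + 2 <= e / 2 * n%:R.
  rewrite mulrC -ler_pdivrMr; last lra.
  by apply: ltW; apply: lt_le_trans (truncnS_gt _) _; rewrite ler_nat.
have C1 := ler_norm C; have C0 := normr_ge0 C.
have := lower n; have := hC n; rewrite mr => up low.
rewrite ler_distlC; apply/andP; split.
  rewrite ler_pdivlMr// mulrBl mulrC; lra.
rewrite ler_pdivrMr// mulrDl mulrC; lra.
Qed.
End substitution.

(** * Sums of hinges *)

Section hinge.
Context {R : realType}.

Definition hinge (c y : R) : R := Num.max (y / c - 1) 0.

Lemma hinge_ge0 (c y : R) : 0 <= hinge c y.
Proof. by rewrite le_max lexx orbT. Qed.

Lemma hinge_ge (c y : R) : y / c - 1 <= hinge c y.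
Proof. by rewrite le_max lexx. Qed.

Lemma hinge_left (c y : R) : 0 < c -> y <= c -> hinge c y = 0.
Proof. by move=> c0 yc; rewrite /hinge max_r// subr_le0 ler_pdivrMr// mul1r. Qed.

Lemma hinge_right (c y : R) : 0 < c -> c <= y -> hinge c y = y / c - 1.
Proof. by move=> c0 yc; rewrite /hinge max_l// subr_ge0 ler_pdivlMr// mul1r. Qed.

Lemma hinge_incr (c y z : R) : 0 < c -> y <= z ->
  0 <= hinge c z - hinge c y <= (z - y) / c.
Proof.
move=> c0 yz; have ci : 0 < c^-1 by rewrite invr_gt0.
have yzc : y / c <= z / c by rewrite ler_pM2r.
have [yc|yc] := lerP y c; have [zc|cz] := lerP z c.
- by rewrite !hinge_left// subrr lexx /= divr_ge0 ?subr_ge0// ltW.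
- rewrite (hinge_left c0 yc) (hinge_right c0 (ltW cz)) subr0.
  have : 1 <= z / c by rewrite ler_pdivlMr// mul1r ltW.
  have : y / c <= 1 by rewrite ler_pdivrMr// mul1r.
  by rewrite mulrBl => ? ?; apply/andP; split; lra.
- by have := lt_le_trans yc (le_trans yz zc); rewrite ltxx.
- rewrite (hinge_right c0 (ltW yc)) (hinge_right c0 (ltW cz)) mulrBl.
  by apply/andP; split; lra.
Qed.

Lemma hinge_lip (c y z : R) : 0 < c -> `|hinge c y - hinge c z| <= `|y - z| / c.
Proof.
move=> c0; wlog yz : y z / y <= z.
  move=> h; case/orP: (le_total y z) => [/h//|/h H].
  by rewrite (distrC (hinge c y)) (distrC y).
have /andP[h1 h2] := hinge_incr c0 yz.
by rewrite distrC (distrC y) (ger0_norm h1) ger0_norm ?subr_ge0.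
Qed.

Lemma hinge_not_derivable (c : R) : 0 < c -> ~ derivable (hinge c) c 1.
Proof.
move=> c0; rewrite /derivable => /cvg_ex[/= L /cvgrPdist_lt hL].
have c4 : 0 < c^-1 / 4 by rewrite divr_gt0// invr_gt0.
have [e /= e0 he] := hL _ c4.
have q (h : R) : h != 0 -> `|h| < e -> `|L - h^-1 * (hinge c (h + c) - hinge c c)| < c^-1 / 4.
  move=> h0 hne; have := he h; rewrite /= sub0r normrN => /(_ hne h0).
  by rewrite /GRing.scale /= mulr1.
have hc : hinge c c = 0 by rewrite hinge_left.
have p1 := q (e / 2); have p2 := q (- (e / 2)).
have e2 : 0 < e / 2 by lra.
rewrite hc !subr0 in p1 p2.
rewrite hinge_right// ?lerDr ?(ltW e2)// in p1.
rewrite hinge_left// ?gerDr ?oppr_le0 ?(ltW e2)// mulr0 subr0 in p2.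
have e2n : e / 2 != 0 by rewrite gt_eqF.
have e2l : `|e / 2| < e by rewrite gtr0_norm//; lra.
have {}p1 := p1 e2n e2l.
have {}p2 := p2 ltac:(by rewrite oppr_eq0) ltac:(by rewrite normrN).
rewrite (_ : _ * _ = c^-1) in p1; last first.
  by field; rewrite !gt_eqF.
have ci : 0 < c^-1 by rewrite invr_gt0.
move: p1 p2; rewrite !ltr_norml => /andP[? ?] /andP[? ?]; lra.
Qed.

End hinge.

Section hinge_series.
Context {R : realType}.
Variables (alpha : R) (c : nat -> R).
Hypotheses (alpha0 : 0 < alpha) (c_ge : forall k, alpha <= c k).

Let c0 k : 0 < c k := lt_le_trans alpha0 (c_ge k).

Definition hinge_sum (d : nat -> R) (n : nat) (y : R) : R :=
  \sum_(k < n) d k * hinge (c k) y.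

Definition hinge_series (d : nat -> R) (y : R) : R := limn (fun n => hinge_sum d n y).

Definition summable_weight (d : nat -> R) : Prop := (forall k, 0 <= d k) /\
  forall m n, \sum_(m <= k < n) d k <= m.+1%:R^-1.

Variable d : nat -> R.
Hypothesis hd : summable_weight d.
Let d0 k : 0 <= d k := hd.1 k.

Lemma weighted_sum_le (m n : nat) (f : nat -> R) (C : R) : 0 <= C ->
  (forall k, `|f k| <= C) -> `|\sum_(m <= k < n) d k * f k| <= C * m.+1%:R^-1.
Proof.
move=> C0 fC; apply: le_trans (ler_norm_sum _ _ _) _.
apply: le_trans (_ : C * \sum_(m <= k < n) d k <= _); last first.
  by rewrite ler_wpM2l//; exact: hd.2.
rewrite mulr_sumr; apply: ler_sum => k _.
by rewrite normrM (ger0_norm (d0 k)) mulrC ler_wpM2r.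
Qed.

Lemma hinge_sum_split (m n : nat) (y : R) : (m <= n)%N ->
  hinge_sum d n y = hinge_sum d m y + \sum_(m <= k < n) d k * hinge (c k) y.
Proof.
move=> mn; rewrite /hinge_sum -!(big_mkord xpredT (fun k => d k * hinge (c k) y)).
by rewrite (big_cat_nat _ mn).
Qed.

Lemma hinge_le (k : nat) (y : R) : `|hinge (c k) y| <= (`|y| + alpha) / alpha.
Proof.
rewrite ger0_norm ?hinge_ge0// /hinge ge_max; apply/andP; split; last first.
  by rewrite divr_ge0 ?addr_ge0// ltW.
apply: le_trans (_ : `|y| / c k <= _).
  rewrite lerBlDr; apply: le_trans (_ : `|y| / c k <= _); last by rewrite lerDl.
  by rewrite ler_pM2r ?invr_gt0 ?ler_norm.
apply: le_trans (_ : `|y| / alpha <= _); last first.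
  by rewrite ler_pM2r ?invr_gt0// lerDl ltW.
by rewrite ler_wpM2l// lef_pV2 ?posrE.
Qed.

Lemma hinge_sum_nd (y : R) : nondecreasing_seq (fun n => hinge_sum d n y).
Proof.
move=> m n mn; rewrite (hinge_sum_split y mn) lerDl; apply: sumr_ge0 => k _.
by rewrite mulr_ge0// hinge_ge0.
Qed.

Lemma hinge_sum_cvg (y : R) : hinge_sum d n y @[n --> \oo] --> hinge_series d y.
Proof.
apply: nondecreasing_is_cvgn; first exact: hinge_sum_nd.
exists ((`|y| + alpha) / alpha * 1%:R^-1) => _ [n _ <-].
rewrite /hinge_sum -(big_mkord xpredT (fun k => d k * hinge (c k) y)).
apply: le_trans (ler_norm _) _; apply: weighted_sum_le; last by move=> k; exact: hinge_le.
by rewrite divr_ge0 ?addr_ge0// ltW.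
Qed.

Lemma hinge_sum_le (n : nat) (y : R) : hinge_sum d n y <= hinge_series d y.
Proof.
apply: (nondecreasing_cvgn_le (hinge_sum_nd y)).
by apply: cvgP; exact: hinge_sum_cvg.
Qed.

Lemma hinge_tail_lip (n : nat) (y z : R) :
  `|(hinge_series d y - hinge_sum d n y) - (hinge_series d z - hinge_sum d n z)| <=
  `|y - z| / alpha * n.+1%:R^-1.
Proof.
have cv : (hinge_sum d m y - hinge_sum d n y) - (hinge_sum d m z - hinge_sum d n z)
    @[m --> \oo] -->
    (hinge_series d y - hinge_sum d n y) - (hinge_series d z - hinge_sum d n z).
  by apply: cvgB; apply: cvgB; try exact: hinge_sum_cvg; exact: cvg_cst.
rewrite -(cvg_lim _ (cvg_norm cv))//.
apply: limr_le; first by apply: cvgP; exact: (cvg_norm cv).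
exists n => // m /= nm.
rewrite !(hinge_sum_split _ nm) ![hinge_sum d n _ + _]addrC !addrK -sumrB.
under eq_bigr do rewrite -mulrBr.
apply: weighted_sum_le; first by rewrite divr_ge0// ltW.
move=> k; apply: le_trans (hinge_lip _ _ (c0 k)) _.
by rewrite ler_wpM2l// lef_pV2 ?posrE.
Qed.

Definition slope_sum (b : R) (n : nat) : R := \sum_(k < n) d k * ((c k < b)%R%:R / c k).

Lemma slope_sum_diff (b : R) (m n : nat) : (m <= n)%N ->
  `|slope_sum b n - slope_sum b m| <= alpha^-1 * m.+1%:R^-1.
Proof.
move=> mn; rewrite /slope_sum -!(big_mkord xpredT (fun k => d k * ((c k < b)%R%:R / c k))).
rewrite (big_cat_nat _ mn)//= addrAC subrr add0r.
apply: weighted_sum_le; first by rewrite invr_ge0 ltW.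
move=> k; rewrite ger0_norm ?divr_ge0// ?(ltW (c0 k))//.
apply: le_trans (_ : (c k)^-1 <= _); last by rewrite lef_pV2 ?posrE.
by case: (c k < b); rewrite ?mul1r// mul0r invr_ge0 ltW.
Qed.

Lemma slope_sum_cvg (b : R) : cvgn (slope_sum b).
Proof.
apply: nondecreasing_is_cvgn.
  apply/nondecreasing_seqP => n; rewrite /slope_sum big_ord_recr /= lerDl.
  by rewrite mulr_ge0// divr_ge0// ltW.
exists (alpha^-1 * 1%:R^-1) => _ [n _ <-].
have := slope_sum_diff b (leq0n n); rewrite {2}/slope_sum big_ord0 subr0.
exact/le_trans/ler_norm.
Qed.

(** Near b each hinge with its kink elsewhere is affine, and the tails of the series
have arbitrarily small Lipschitz constants, so the difference quotients converge
to the sum of the slopes of the hinges that are open at b. *)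
Lemma hinge_series_derivable (b : R) :
  (forall k, d k != 0 -> c k != b) -> derivable (hinge_series d) b 1.
Proof.
move=> hb; pose D := limn (slope_sum b).
have Dn m : `|D - slope_sum b m| <= alpha^-1 * m.+1%:R^-1.
  have cv : `|slope_sum b n - slope_sum b m| @[n --> \oo] --> `|D - slope_sum b m|.
    by apply: cvg_norm; apply: cvgB; [exact: slope_sum_cvg|exact: cvg_cst].
  rewrite -(cvg_lim _ cv)//; apply: limr_le; first by apply: cvgP; exact: cv.
  by exists m => // n /= mn; exact: slope_sum_diff.
apply/cvg_ex; exists D; apply/cvgrPdist_le => e e0.
pose n := Num.truncn (alpha^-1 / (e / 2)).
have ne : alpha^-1 * n.+1%:R^-1 <= e / 2.
  rewrite ler_pdivrMr ?ltr0n// -ler_pdivrMl; last lra.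
  by rewrite mulrC ltW// truncnS_gt.
have [del [del0 hdel]] : exists del : R, 0 < del /\
    forall k, (k < n)%N -> d k != 0 -> del <= `|b - c k|.
  elim: (n) => [|m [del [del0 IH]]]; first by exists 1.
  have [dm|dm] := eqVneq (d m) 0.
    exists del; split => // k; rewrite ltnS leq_eqVlt => /orP[/eqP ->|]; last exact: IH.
    by rewrite dm eqxx.
  exists (Num.min del `|b - c m|); split.
    by rewrite lt_min del0 normr_gt0 subr_eq0 eq_sym hb.
  move=> k; rewrite ltnS leq_eqVlt ge_min => /orP[/eqP ->|km dk]; first by rewrite lexx orbT.
  by rewrite IH.
exists del => // h /= hdl h0; rewrite sub0r normrN in hdl.
rewrite /GRing.scale /= mulr1.
have hS : hinge_sum d n (h + b) - hinge_sum d n b = h * slope_sum b n.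
  rewrite /hinge_sum /slope_sum -sumrB mulr_sumr; apply: eq_bigr => k _.
  have [->|dk] := eqVneq (d k) 0; first by rewrite !mul0r mulr0 subr0.
  have := lt_le_trans hdl (hdel k (ltn_ord k) dk).
  rewrite -mulrBr mulrCA; have [cb|bc|cb] := ltgtP (c k) b; last first.
  - by have := hb k dk; rewrite cb eqxx.
  - have nb : b - c k < 0 by rewrite subr_lt0.
    rewrite (ltr0_norm nb) => hl.
    have hb1 : h + b <= c k by have := ler_norm h; lra.
    by rewrite !hinge_left ?(ltW bc)// mul0r !mulr0 subr0 mulr0.
  - have nb : 0 < b - c k by rewrite subr_gt0.
    rewrite (gtr0_norm nb) => hl.
    have hb1 : c k <= h + b by have := ler_norm (- h); rewrite normrN; lra.
    rewrite !hinge_right ?(ltW cb)// mul1r; congr (_ * _).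
    by rewrite mulrDl; lra.
have tl := hinge_tail_lip n (h + b) b; rewrite addrK in tl.
have -> : D - h^-1 * (hinge_series d (h + b) - hinge_series d b) =
    (D - slope_sum b n) - h^-1 * ((hinge_series d (h + b) - hinge_sum d n (h + b)) -
      (hinge_series d b - hinge_sum d n b)).
  have -> : slope_sum b n = h^-1 * (hinge_sum d n (h + b) - hinge_sum d n b).
    by rewrite hS mulKf.
  by ring.
apply: le_trans (ler_normB _ _) _; rewrite (splitr e); apply: lerD.
  exact: le_trans (Dn n) ne.
rewrite normrM normfV ler_pdivrMl ?normr_gt0//; apply: le_trans tl _.
by rewrite -mulrA ler_wpM2l.
Qed.

End hinge_series.

Section hinge_series_kinks.
Context {R : realType}.
Variables (alpha : R) (c : nat -> R).
Hypotheses (alpha0 : 0 < alpha) (c_ge : forall k, alpha <= c k).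
Variable d : nat -> R.
Hypothesis hd : summable_weight d.

(** Without the hinge at c k0 the series would be derivable there, hence so would
that hinge. *)
Lemma hinge_series_not_derivable (k0 : nat) : 0 < d k0 ->
  (forall k, k != k0 -> d k != 0 -> c k != c k0) ->
  ~ derivable (hinge_series c d) (c k0) 1.
Proof.
move=> dk0 hk; pose d' k := if k == k0 then 0 else d k.
have hd' : summable_weight d'.
  split=> [k|m n]; first by rewrite /d'; case: ifP => // _; exact: hd.1.
  apply: le_trans (hd.2 m n); apply: ler_sum => k _.
  by rewrite /d'; case: ifP => // _; exact: hd.1.
have E y : hinge_series c d y = hinge_series c d' y + d k0 * hinge (c k0) y.
  have cv : hinge_sum c d' n y + d k0 * hinge (c k0) y @[n --> \oo] -->
      hinge_series c d' y + d k0 * hinge (c k0) y.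
    by apply: cvgD; [exact: (hinge_sum_cvg alpha0 c_ge hd')|exact: cvg_cst].
  apply: cvg_lim => //; apply: cvg_trans cv; apply: near_eq_cvg.
  exists k0.+1 => // n /= kn.
  suff -> : hinge_sum c d n y = hinge_sum c d' n y + d k0 * hinge (c k0) y by [].
  rewrite /hinge_sum (bigD1 (Ordinal kn))//= [in RHS](bigD1 (Ordinal kn))//=.
  rewrite /d' eqxx mul0r add0r addrC; congr (_ + _); apply: eq_bigr => k kk0.
  by case: eqP => // e; case/eqP: kk0; apply: val_inj.
have D' : derivable (hinge_series c d') (c k0) 1.
  apply: (hinge_series_derivable alpha0 c_ge hd') => k; rewrite /d'.
  by case: (eqVneq k k0) => [_|kk0]; [rewrite eqxx|exact: hk].
move=> D; apply: (@hinge_not_derivable _ (c k0)); first exact: lt_le_trans (c_ge _).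
have -> : hinge (c k0) = (d k0)^-1 \*: (hinge_series c d - hinge_series c d').
  apply/funext => y.
  transitivity ((d k0)^-1 * (d k0 * hinge (c k0) y)); first by rewrite mulKf ?gt_eqF.
  by rewrite /= !fctE E addrAC subrr add0r.
by apply: derivableZ; apply: derivableB.
Qed.

Lemma hinge_series_incr (n : nat) (y z : R) : y <= z ->
  (forall k, (k < n)%N -> d k != 0 -> c k <= y) ->
  (z - y) * \sum_(k < n) d k / c k <= hinge_series c d z - hinge_series c d y.
Proof.
move=> yz hy.
have c0 k : 0 < c k := lt_le_trans alpha0 (c_ge k).
have cv : hinge_sum c d m z - hinge_sum c d m y @[m --> \oo] -->
    hinge_series c d z - hinge_series c d y.
  by apply: cvgB; exact: (hinge_sum_cvg alpha0 c_ge hd).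
rewrite -(cvg_lim _ cv)//; apply: limr_ge; first by apply: cvgP; exact: cv.
exists n => // m /= nm; rewrite /hinge_sum -sumrB.
rewrite -(big_mkord xpredT (fun k => d k * hinge (c k) z - d k * hinge (c k) y)).
rewrite (big_cat_nat _ nm)//= big_mkord -[leLHS]addr0 mulr_sumr; apply: lerD.
  apply: ler_sum => k _; have [->|dk] := eqVneq (d k) 0; first by rewrite !mul0r mulr0 subrr.
  have ck := hy k (ltn_ord k) dk.
  rewrite !hinge_right ?(le_trans ck yz)// -mulrBr mulrCA ler_wpM2l ?hd.1//.
  by rewrite mulrBl; lra.
apply: sumr_ge0 => k _; rewrite -mulrBr mulr_ge0 ?hd.1//.
by have /andP[] := hinge_incr (c0 k) yz.
Qed.

Lemma hinge_series_slope_cvg (y : R) : (forall k, d k != 0 -> c k <= y) ->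
  \sum_(k < n) d k / c k @[n --> \oo] --> hinge_series c d (y + 1) - hinge_series c d y.
Proof.
move=> hy.
have c0 k : 0 < c k := lt_le_trans alpha0 (c_ge k).
have cv : hinge_sum c d m (y + 1) - hinge_sum c d m y @[m --> \oo] -->
    hinge_series c d (y + 1) - hinge_series c d y.
  by apply: cvgB; exact: (hinge_sum_cvg alpha0 c_ge hd).
apply: cvg_trans cv; apply: near_eq_cvg; apply: nearW => n.
rewrite /hinge_sum -sumrB; apply: eq_bigr => k _.
have [->|dk] := eqVneq (d k) 0; first by rewrite !mul0r subrr.
have ck := hy k dk.
rewrite !hinge_right//; last by lra.
by rewrite -mulrBr mulrDl; congr (_ * _); lra.
Qed.

Lemma hinge_series_affine (y z : R) : y <= z -> (forall k, d k != 0 -> c k <= y) ->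
  hinge_series c d z - hinge_series c d y =
  (z - y) * (hinge_series c d (y + 1) - hinge_series c d y).
Proof.
move=> yz hy.
have c0 k : 0 < c k := lt_le_trans alpha0 (c_ge k).
have cv : hinge_sum c d m z - hinge_sum c d m y @[m --> \oo] -->
    hinge_series c d z - hinge_series c d y.
  by apply: cvgB; exact: (hinge_sum_cvg alpha0 c_ge hd).
rewrite -(cvg_lim _ cv)//; apply: cvg_lim => //.
have cs : (z - y) * \sum_(k < n) d k / c k @[n --> \oo] -->
    (z - y) * (hinge_series c d (y + 1) - hinge_series c d y).
  by apply: cvgMr; exact: hinge_series_slope_cvg.
apply: cvg_trans cs; apply: near_eq_cvg; apply: nearW => n.
rewrite /hinge_sum -sumrB mulr_sumr; apply: eq_bigr => k _.
have [->|dk] := eqVneq (d k) 0; first by rewrite !mul0r mulr0 subrr.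
have ck := hy k dk.
rewrite !hinge_right//; last exact: le_trans yz.
by rewrite -mulrBr mulrCA; congr (_ * _); rewrite mulrBl; lra.
Qed.

End hinge_series_kinks.

(** * The potential and its pressure *)

Section potential.
Context {R : realType}.
Local Notation X := borel_full_shift.
Variables (alpha : R) (N : option nat) (beta : nat -> R).
Hypothesis alpha_gt0 : 0 < alpha.
Hypothesis beta_ge : forall n, seq_index N n -> alpha <= beta n.
Hypothesis beta_incr : forall m n, seq_index N m -> seq_index N n ->
  (m < n)%N -> beta m < beta n.

Definition in_range (k : nat) : bool := if N is Some m then (k < m)%N else true.

Lemma in_rangeP (k : nat) : seq_index N k <-> in_range k.
Proof. by rewrite /seq_index /in_range /=; case: N. Qed.

(** The token lengths in use.  For a finite sequence they stop growing, so that the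
terms of [target] beyond its end vanish. *)
Definition level (n : nat) : nat := ((if N is Some m then minn n m else n) + 3)%N.

Definition height (n : nat) : R := (level n)%:R^-1.

Definition height_drop (k : nat) : R := height k - height k.+1.

Definition kink (k : nat) : R := if in_range k then beta k else alpha.

Lemma kink_ge (k : nat) : alpha <= kink k.
Proof. by rewrite /kink; case: ifP => // /in_rangeP; exact: beta_ge. Qed.

Lemma kink_gt0 (k : nat) : 0 < kink k.
Proof. exact: lt_le_trans alpha_gt0 (kink_ge k). Qed.

Lemma level_gt0 (n : nat) : 0 < (level n)%:R :> R.
Proof. by rewrite ltr0n /level addnS. Qed.

Lemma height_le (m n : nat) : (m <= n)%N -> height n <= height m.
Proof.
move=> mn; rewrite /height lef_pV2 ?posrE ?level_gt0// ler_nat /level.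
by case: N => [M|]; lia.
Qed.

Lemma height_drop_ge0 (k : nat) : 0 <= height_drop k.
Proof. by rewrite subr_ge0 height_le. Qed.

Lemma height_drop_gt0 (k : nat) : in_range k -> 0 < height_drop k.
Proof.
move=> ik; rewrite subr_gt0 /height ltf_pV2 ?posrE ?level_gt0// ltr_nat /level.
by move: ik; rewrite /in_range; case: N => [M|]; lia.
Qed.

Lemma height_drop_index (k : nat) : height_drop k != 0 -> in_range k.
Proof.
apply: contraNT => ik; rewrite subr_eq0 /height /level.
move: ik; rewrite /in_range; case: N => [M|]// kM.
by rewrite (_ : minn k.+1 M = minn k M)//; lia.
Qed.

Lemma sum_height_drop (m n : nat) : (m <= n)%N ->
  \sum_(m <= k < n) height_drop k = height m - height n.
Proof.
move=> mn; rewrite /height_drop -[LHS]opprK -sumrN.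
by under eq_bigr do rewrite opprB; rewrite telescope_sumr// opprB.
Qed.

Lemma height_drop_summable : summable_weight height_drop.
Proof.
split=> [|m n]; first exact: height_drop_ge0.
have [nm|mn] := leqP n m; first by rewrite big_geq.
rewrite sum_height_drop ?(ltnW mn)//.
have h : height n = height m \/ height m <= m.+1%:R^-1.
  rewrite /height /level; case: N => [M|]; last first.
    by right; rewrite lef_pV2 ?posrE ?ltr0n ?addnS// ler_nat; lia.
  have [Mm|mM] := leqP M m; first by left; rewrite !(minn_idPr _)//; lia.
  by right; rewrite lef_pV2 ?posrE ?ltr0n ?addnS// ler_nat; lia.
have n0 : 0 <= height n by rewrite invr_ge0 ltW// level_gt0.
have m0 : 0 <= m.+1%:R^-1 :> R by rewrite invr_ge0.
case: h => [->|h]; first by rewrite subrr.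
by rewrite lerBlDr (le_trans h)// lerDl.
Qed.

(** The prescribed pressure. *)
Definition target (y : R) : R := height 0 + hinge_series kink height_drop y.

(** The slope of [target] once exactly the first n hinges are open; the line with this
slope and value height n at 0 supports [target]. *)
Definition mean_slope (n : nat) : R := \sum_(k < n) height_drop k / kink k.

Lemma support_lineE (n : nat) (y : R) :
  height n + y * mean_slope n = height 0 + \sum_(k < n) height_drop k * (y / kink k - 1).
Proof.
under [in RHS]eq_bigr do rewrite mulrBr mulr1.
rewrite sumrB -(big_mkord xpredT height_drop) sum_height_drop// /mean_slope mulr_sumr.
under eq_bigr do rewrite mulrCA.
by ring.
Qed.

Lemma support_line_le (n : nat) (y : R) : height n + y * mean_slope n <= target y.
Proof.
rewrite support_lineE lerD2l.
apply: le_trans (hinge_sum_le alpha_gt0 kink_ge height_drop_summable n y).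
apply: ler_sum => k _; apply: ler_wpM2l; first exact: height_drop_ge0.
exact: hinge_ge.
Qed.

(** Since the kinks increase, the hinges that are open at y are those before some
index j. *)
Lemma support_line_attained (n : nat) (y : R) : exists j,
  height 0 + hinge_sum kink height_drop n y <= height j + y * mean_slope j.
Proof.
suff [j hj] : exists j,
    hinge_sum kink height_drop n y <= \sum_(k < j) height_drop k * (y / kink k - 1).
  by exists j; rewrite support_lineE lerD2l.
elim: n => [|n [j IH]]; first by exists 0%N; rewrite /hinge_sum !big_ord0.
have skip : height_drop n * hinge (kink n) y = 0 ->
    hinge_sum kink height_drop n.+1 y <= \sum_(k < j) height_drop k * (y / kink k - 1).
  by rewrite /hinge_sum big_ord_recr /= => ->; rewrite addr0.
have [dn|dn] := eqVneq (height_drop n) 0; first by exists j; apply: skip; rewrite dn mul0r.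
have [yn|ny] := lerP y (kink n).
  by exists j; apply: skip; rewrite hinge_left ?mulr0// kink_gt0.
exists n.+1; apply: ler_sum => k _.
have [->|dk] := eqVneq (height_drop k) 0; first by rewrite !mul0r.
rewrite hinge_right ?kink_gt0//; apply: le_trans (ltW ny).
have [->//|kn] := eqVneq (val k) n.
have ik := height_drop_index dk; have i_n := height_drop_index dn.
rewrite /kink ik i_n ltW//; apply: beta_incr; [exact/in_rangeP|exact/in_rangeP|].
by rewrite ltn_neqAle kn -ltnS ltn_ord.
Qed.

Definition bounds (t : R) : set R :=
  [set (target y - t) / y | y in [set y | alpha / 2 <= y]].

(** The largest g with t + y * g t <= target y for all y >= alpha / 2.  Starting at
alpha / 2 keeps the pressure equal to [target] on both sides of alpha. *)
Definition profile (t : R) : R := inf (bounds t).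

Lemma half_gt0 : 0 < alpha / 2.
Proof. by rewrite divr_gt0. Qed.

Lemma target_ge0 (y : R) : 0 <= target y.
Proof.
rewrite addr_ge0// ?invr_ge0 ?(ltW (level_gt0 _))//.
apply: le_trans (hinge_sum_le alpha_gt0 kink_ge height_drop_summable 0 y).
by rewrite /hinge_sum big_ord0.
Qed.

Lemma bounds_has_inf (t : R) : has_inf (bounds t).
Proof.
split; first by exists ((target (alpha / 2) - t) / (alpha / 2)), (alpha / 2) => /=.
exists (- (`|t| / (alpha / 2))) => _ [y /= ay <-].
have y0 : 0 < y := lt_le_trans half_gt0 ay.
apply: le_trans (_ : - (`|t| / y) <= _).
  by rewrite lerN2 ler_wpM2l// lef_pV2 ?posrE ?half_gt0.
rewrite -mulNr ler_pM2r ?invr_gt0//.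
by have := target_ge0 y; have := ler_norm t; lra.
Qed.

Lemma profile_le (t y : R) : alpha / 2 <= y -> t + y * profile t <= target y.
Proof.
move=> ay; have y0 : 0 < y := lt_le_trans half_gt0 ay.
rewrite -lerBrDl mulrC -ler_pdivlMr//; apply: ge_inf.
  exact: (bounds_has_inf t).2.
by exists y.
Qed.

Lemma profile_ge (t v : R) : (forall y, alpha / 2 <= y -> t + y * v <= target y) ->
  v <= profile t.
Proof.
move=> h; apply: lb_le_inf; first exact: (bounds_has_inf t).1.
move=> _ [y /= ay <-]; have y0 : 0 < y := lt_le_trans half_gt0 ay.
by rewrite ler_pdivlMr// mulrC lerBrDl h.
Qed.

Lemma profile_lip (s t : R) : profile t - `|t - s| / (alpha / 2) <= profile s.
Proof.
apply: profile_ge => y ay; have y0 : 0 < y := lt_le_trans half_gt0 ay.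
have := profile_le t ay.
have : `|t - s| <= y * (`|t - s| / (alpha / 2)).
  by rewrite mulrCA ler_peMr// ler_pdivlMr ?half_gt0// mul1r.
have := ler_norm (- (t - s)); rewrite normrN mulrBr; lra.
Qed.

Lemma profile_continuous : continuous profile.
Proof.
move=> t; apply/cvgrPdist_le => e e0.
have ea : 0 < e * (alpha / 2) by rewrite mulr_gt0// half_gt0.
exists (e * (alpha / 2)) => // s /= ts.
have d1 : `|t - s| / (alpha / 2) <= e by rewrite ler_pdivrMr ?half_gt0// ltW.
have := profile_lip s t; have := profile_lip t s; rewrite (distrC s).
by rewrite ler_distl => ? ?; apply/andP; split; lra.
Qed.

Definition potential (x : full_shift) : R := profile (rate x).

Lemma potential_continuous : continuous potential.
Proof.
move=> x; apply: (@continuous_comp _ _ _ rate profile).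
  exact: rate_continuous.
exact: profile_continuous.
Qed.

Lemma bm_potential : bounded_measurable (potential : X -> R).
Proof.
split; first by apply: continuous_borel; exact: potential_continuous.
have [C hC] := @rate_bounded R.
exists (`|profile 0| + C / (alpha / 2)) => x.
have r0 := @rate_ge0 R x.
have rC : rate x / (alpha / 2) <= C / (alpha / 2) by rewrite ler_pM2r ?invr_gt0 ?half_gt0.
have := profile_lip 0 (rate x); have := profile_lip (rate x) 0.
rewrite sub0r subr0 normrN (ger0_norm r0) /potential => h1 h2.
have := ler_norm (profile 0); have := ler_norm (- profile 0); rewrite normrN => h3 h4.
by rewrite ler_norml; apply/andP; split; lra.
Qed.

Lemma free_energy_potential (mu : probability X R) (y : R) :
  free_energy (fun x => y * potential x) mu = (entropy mu + (y * mean mu potential)%:E)%E.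
Proof.
rewrite /free_energy; congr (_ + _)%E.
rewrite -meanZ; last exact: bm_potential.
by apply: meanE; apply: bmZ; exact: bm_potential.
Qed.

(** The upper bound integrates rate + y potential <= target y.  For the lower bound,
the measure on tokens of length level j attains the j-th supporting line. *)
Lemma pressure_potential (y : R) : alpha / 2 <= y ->
  pressure (fun x => y * potential x) = (target y)%:E.
Proof.
move=> ay; have y0 : 0 < y := lt_le_trans half_gt0 ay.
apply/eqP; rewrite eq_le; apply/andP; split.
  apply: ub_ereal_sup => _ [mu inv <-]; rewrite free_energy_potential.
  apply: le_trans (leeD2r _ (entropy_le_mean_rate inv)) _.
  rewrite -EFinD lee_fin -meanZ; last exact: bm_potential.
  have bp := bmZ y bm_potential.
  rewrite -meanD//; last exact: bm_rate.
  rewrite -[leRHS](mean_cst mu); apply: mean_le => //; [|exact: bm_cst|].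
    by apply: bmD => //; exact: bm_rate.
  by move=> x; exact: profile_le.
have line j : ((height j + y * mean_slope j)%:E <=
    pressure (fun x => (y * potential x)%R))%E.
  have l3 : (3 <= level j)%N by rewrite /level leq_addl.
  have [mu [inv hmean hent]] := @substitute_measure R _ l3.
  apply: le_trans (_ : free_energy (fun x => y * potential x)%R mu <= _)%E; last first.
    by apply: ereal_sup_ubound; exists mu.
  rewrite free_energy_potential EFinD; apply: leeD => //.
  rewrite lee_fin ler_pM2l// (hmean potential (profile (height j))).
  - by apply: profile_ge => z _; exact: support_line_le.
  - exact: bm_potential.
  - by move=> x rx; rewrite /potential rx.
have part n : ((height 0 + hinge_sum kink height_drop n y)%:E <=
    pressure (fun x => (y * potential x)%R))%E.
  by have [j hj] := support_line_attained n y; apply: le_trans (line j); rewrite lee_fin.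
case: (pressure _) part => [r| |] part;
  [|exact: leey|by have := part 0%N; rewrite leeNy_eq].
rewrite lee_fin /target -lerBrDl.
have cv : hinge_sum kink height_drop n y @[n --> \oo] --> hinge_series kink height_drop y.
  exact: (hinge_sum_cvg alpha_gt0 kink_ge height_drop_summable).
apply: limr_le; first by apply: cvgP; exact: cv.
by apply: nearW => n; rewrite lerBrDl -lee_fin.
Qed.

Lemma derivable_pressure (b : R) : alpha <= b ->
  derivable (fun y : R => fine (pressure (fun x => y * potential x))) b 1 <->
  derivable (hinge_series kink height_drop) b 1.
Proof.
move=> ab.
have E : \forall y \near b,
    fine (pressure (fun x => y * potential x)) = height 0 + hinge_series kink height_drop y.
  apply: (@filterS _ _ _ [set y | alpha / 2 < y]).
    by move=> y /ltW ay; rewrite pressure_potential.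
  apply: open_nbhs_nbhs; split; first exact: open_gt.
  by apply: lt_le_trans ab; rewrite ltr_pdivrMr// ltr_pMr// ltr1n.
split => D.
  have -> : hinge_series kink height_drop =
      (fun y => (height 0 + hinge_series kink height_drop y) - height 0).
    by apply/funext => y; rewrite addrC addKr.
  apply: derivableB; last exact: derivable_cst.
  exact: near_eq_derivable E D.
apply: (near_eq_derivable (f := fun y => height 0 + hinge_series kink height_drop y)).
  by apply: filterS E => y ->.
by apply: derivableD => //; exact: derivable_cst.
Qed.

Lemma potential_phase_transition (b : R) : alpha <= b ->
  (phase_transition_at potential b <-> exists n, seq_index N n /\ b = beta n).
Proof.
move=> ab; rewrite /phase_transition_at; split.
  move=> nD; apply: contrapT => no; apply: nD; apply/(derivable_pressure ab).
  apply: (hinge_series_derivable alpha_gt0 kink_ge height_drop_summable) => k dk.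
  apply/eqP => kb; apply: no; exists k; have ik := height_drop_index dk.
  by split; [exact/in_rangeP|rewrite -kb /kink ik].
move=> [n [i_n bn]] /(derivable_pressure ab).
have ibn := (in_rangeP n).1 i_n.
have -> : b = kink n by rewrite /kink ibn.
apply: (hinge_series_not_derivable alpha_gt0 kink_ge height_drop_summable); first exact: height_drop_gt0.
move=> k kn dk; have ik := height_drop_index dk; rewrite /kink ik ibn.
have sk := (in_rangeP k).2 ik.
have [lt|gt|e] := ltngtP k n; last by rewrite e eqxx in kn.
  by rewrite lt_eqF// beta_incr.
by rewrite gt_eqF// beta_incr.
Qed.

Lemma equilibrium_values (mu : probability X R) (b : R) : alpha / 2 <= b ->
  equilibrium_states (fun x => b * potential x) mu ->
  exists e : R, [/\ entropy mu = e%:E, e + b * mean mu potential = target b &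
    forall y, alpha / 2 <= y -> e + y * mean mu potential <= target y].
Proof.
move=> ab [inv hfree].
have efin : entropy mu \is a fin_num.
  rewrite fin_numE gt_eqF ?entropy_gtNy//= lt_eqF//.
  exact: le_lt_trans (entropy_le_mean_rate inv) (ltry _).
exists (fine (entropy mu)); rewrite fineK//; split => //.
  apply: EFin_inj; rewrite EFinD fineK// -free_energy_potential hfree.
  exact: pressure_potential.
move=> y ay; rewrite -lee_fin EFinD fineK// -free_energy_potential -pressure_potential//.
by apply: ereal_sup_ubound; exists mu.
Qed.

(** The line y |-> e + y I of an equilibrium state lies below [target] and touches it
at b.  Comparison with the point b + 1 gives I <= slope, and comparison with the
kinks below b gives the reverse inequality, so the line is the affine part of
[target] beyond boo and touches [target] at b' as well. *)
Lemma potential_equilibrium_sub (boo b b' : R) : N = None ->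
  beta n @[n --> \oo] --> boo -> boo <= b -> boo <= b' ->
  equilibrium_states (fun x => b * potential x) `<=`
  equilibrium_states (fun x => b' * potential x).
Proof.
move=> NN cvb bb bb' mu eqb.
have idx k : in_range k by rewrite /in_range NN.
have kE k : kink k = beta k by rewrite /kink idx.
have lt_boo k : kink k < boo.
  have nd : nondecreasing_seq beta.
    apply/nondecreasing_seqP => n; apply: ltW; apply: beta_incr => //; exact/in_rangeP.
  rewrite kE; apply: lt_le_trans (_ : beta k.+1 <= _).
    by apply: beta_incr => //; exact/in_rangeP.
  rewrite -(cvg_lim _ cvb)//; apply: nondecreasing_cvgn_le => //.
  by apply: cvgP; exact: cvb.
have a_boo : alpha / 2 <= boo.
  apply: le_trans (ltW (lt_boo 0%N)); apply: le_trans (kink_ge 0).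
  by rewrite ler_pdivrMr// ler_peMr ?ler1n// ltW.
pose slope := hinge_series kink height_drop (boo + 1) - hinge_series kink height_drop boo.
have affine y : boo <= y ->
    hinge_series kink height_drop y = hinge_series kink height_drop boo + (y - boo) * slope.
  move=> yb; have := hinge_series_affine alpha_gt0 kink_ge height_drop_summable yb
    (fun k _ => ltW (lt_boo k)).
  by rewrite -/slope => <-; rewrite addrC subrK.
have [e [he hb hy]] := equilibrium_values (le_trans a_boo bb) eqb.
set I := mean mu potential in hb hy.
have I_le : I <= slope.
  have bb1 : boo <= b + 1 by rewrite (le_trans bb)// lerDl.
  have := hy (b + 1) (le_trans a_boo bb1); rewrite /target (affine _ bb1).
  by move: hb; rewrite /target (affine _ bb); lra.
have I_ge : slope <= I.
  have cv : \sum_(k < n) height_drop k / kink k @[n --> \oo] --> slope.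
    apply: (hinge_series_slope_cvg alpha_gt0 kink_ge height_drop_summable) => k _.
    exact: ltW.
  rewrite -(cvg_lim _ cv)//; apply: limr_le; first by apply: cvgP; exact: cv.
  exists 1%N => // -[//|n] _.
  have nb : 0 < b - kink n by rewrite subr_gt0 (lt_le_trans (lt_boo n)).
  rewrite -(ler_pM2l nb).
  have kb : kink n <= b by rewrite -subr_ge0 ltW.
  have below k : (k < n.+1)%N -> height_drop k != 0 -> kink k <= kink n.
    rewrite ltnS leq_eqVlt => /orP[/eqP -> //|kn] _.
    by rewrite !kE ltW// beta_incr//; exact/in_rangeP.
  apply: le_trans (hinge_series_incr alpha_gt0 kink_ge height_drop_summable kb below) _.
  have ak : alpha / 2 <= kink n.
    by apply: le_trans (kink_ge n); rewrite ler_pdivrMr// ler_peMr ?ler1n// ltW.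
  by have := hy _ ak; move: hb; rewrite /target mulrBl; lra.
have IE : I = slope by apply/le_anti; rewrite I_le I_ge.
split; first exact: eqb.1.
rewrite pressure_potential ?(le_trans a_boo)// free_energy_potential he -EFinD -/I.
congr (_%:E); move: hb; rewrite /target (affine _ bb) (affine _ bb') IE; lra.
Qed.

End potential.

Theorem mainTheorem1 (R : realType) (alpha : R) (alpha_gt0 : 0 < alpha)
    (N : option nat) (beta : nat -> R)
    (beta_ge : forall n, seq_index N n -> alpha <= beta n)
    (beta_incr : forall m n, seq_index N m -> seq_index N n ->
      (m < n)%N -> beta m < beta n) :
  exists phi : full_shift -> R,
    [/\ continuous phi,
        (forall b : R, alpha <= b ->
          (phase_transition_at phi b <->
           exists n, seq_index N n /\ b = beta n)) &
        (N = None -> forall beta_oo : R, beta n @[n --> \oo] --> beta_oo ->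
          forall b b' : R, beta_oo <= b -> beta_oo <= b' ->
            equilibrium_states (fun x => b * phi x) =
            equilibrium_states (fun x => b' * phi x))].
Proof.
exists (potential alpha N beta); split.
- exact: potential_continuous.
- by move=> b ab; exact: potential_phase_transition.
- move=> NN boo cv b b' bb bb'.
  by apply/seteqP; split; exact: (potential_equilibrium_sub alpha_gt0 beta_ge beta_incr NN cv).
Qed.
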